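(* Let $Q=(Q_0,Q_1,h,t)$ be a quiver without oriented cycles and let $\alpha\in\mathbb N^{Q_0}$. For every weight $\sigma\in\mathbb Z^{Q_0}$, one has $\sigma\in\Sigma(Q,\alpha)$ if and only if the following two conditions are satisfied: (1) $\sigma(\alpha)=0$; (2) $\sigma(\beta)\leqslant 0$ for all $\beta\in\mathbb N^{Q_0}$ with $\beta\leqslant\alpha$ such that $\langle\beta,\cdot\rangle\in\Sigma(Q,\alpha-\beta)$.
   Context: $\mathbb N$ denotes the non-negative integers. A quiver is a finite oriented graph with vertex set $Q_0$, arrow set $Q_1$, and maps $h,t:Q_1\to Q_0$; an arrow $a$ goes from its tail $ta$ to its head $ha$. A dimension is an element $\alpha\in\mathbb N^{Q_0}$; $\beta\leqslant\alpha$ means $\beta(x)\leqslant\alpha(x)$ for all $x\in Q_0$. Representations of dimension $\alpha$ are the elements of $\mathrm{Rep}_\alpha(Q)=\bigoplus_{a\in Q_1}\mathrm{Mat}_{\alpha(ha),\alpha(ta)}(\mathbb C)$. The group $\mathrm{GL}_\alpha(Q)=\prod_{x\in Q_0}\mathrm{GL}_{\alpha(x)}(\mathbb C)$ acts by $g\cdot V=(g_{ha}V(a)g_{ta}^{-1})_a$, and on polynomial functions $f\in\mathbb C[\mathrm{Rep}_\alpha(Q)]$ by $(g\cdot f)(V)=f(g^{-1}\cdot V)$. A weight is an element $\sigma\in\mathbb Z^{Q_0}$; for $\beta\in\mathbb Z^{Q_0}$ put $\sigma(\beta)=\sum_{x\in Q_0}\sigma(x)\beta(x)$, and let $\chi_\sigma(g)=\prod_{x}\det(g_x)^{\sigma(x)}$.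 Let $\mathrm{SI}(Q,\alpha)_\sigma$ be the space of all $f\in\mathbb C[\mathrm{Rep}_\alpha(Q)]$ with $g\cdot f=\chi_\sigma(g)f$ for all $g\in\mathrm{GL}_\alpha(Q)$, and $\Sigma(Q,\alpha)=\{\sigma\in\mathbb Z^{Q_0}\mid \mathrm{SI}(Q,\alpha)_\sigma\neq\{0\}\}$. The Euler-Ringel form is $\langle\alpha,\beta\rangle=\sum_{x\in Q_0}\alpha(x)\beta(x)-\sum_{a\in Q_1}\alpha(ta)\beta(ha)$ for $\alpha,\beta\in\mathbb Z^{Q_0}$, and $\langle\alpha,\cdot\rangle$ denotes the weight $\sigma$ such that $\sigma(\beta)=\langle\alpha,\beta\rangle$ for all $\beta$. *)

(* Defs.v *)
From mathcomp Require Import all_boot all_order all_algebra.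
From mathcomp Require Import reals complex mpoly.

Set Implicit Arguments.
Unset Strict Implicit.
Unset Printing Implicit Defensive.

Import GRing.Theory.
Local Open Scope ring_scope.

Record quiver := Quiver {
  vertex : finType;
  arrow : finType;
  qhead : arrow -> vertex;
  qtail : arrow -> vertex
}.

(* The arrows a_1, ..., a_n (n > 0) form an oriented cycle when
   h a_i = t a_(i+1) cyclically; n = 1 is a loop. *)
Definition acyclic_quiver (Q : quiver) : Prop :=
  forall p : seq (arrow Q), p != [::] ->
    ~~ cycle (fun a b => qhead a == qtail b) p.

Definition dimension (Q : quiver) := vertex Q -> nat.
Definition weight (Q : quiver) := vertex Q -> int.

Definition dim_le (Q : quiver) (b a : dimension Q) : Prop :=
  forall x, (b x <= a x)%N.

(* Truncated subtraction: only meaningful when dim_le b a. *)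
Definition dim_sub (Q : quiver) (a b : dimension Q) : dimension Q :=
  fun x => (a x - b x)%N.

Definition dimZ (Q : quiver) (a : dimension Q) : vertex Q -> int :=
  fun x => (a x)%:Z.

Definition weight_eval (Q : quiver) (s : weight Q) (b : vertex Q -> int) : int :=
  \sum_(x : vertex Q) s x * b x.

Definition euler_form (Q : quiver) (a b : vertex Q -> int) : int :=
  \sum_(x : vertex Q) a x * b x
  - \sum_(e : arrow Q) a (qtail e) * b (qhead e).

(* <a, .> as a weight: its value at x is the form on the x-th coordinate
   vector; euler_weightE is the property that characterizes it. *)
Definition euler_weight (Q : quiver) (a : vertex Q -> int) : weight Q :=
  fun x => euler_form a (fun y => (y == x)%:R).

Lemma euler_weightE (Q : quiver) (a b : vertex Q -> int) :
  weight_eval (euler_weight a) b = euler_form a b.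
Proof.
rewrite /weight_eval /euler_weight /euler_form.
under eq_bigr do rewrite mulrBl.
rewrite sumrB; congr (_ - _).
  apply: eq_bigr => x _; rewrite (bigD1 x) //= eqxx mulr1.
  by rewrite big1 ?addr0 // => y /negPf ->; rewrite mulr0.
under eq_bigr do rewrite mulr_suml.
rewrite exchange_big /=; apply: eq_bigr => e _.
rewrite (bigD1 (qhead e)) //= eqxx mulr1 big1 ?addr0 // => y.
by rewrite eq_sym => /negPf ->; rewrite mulr0 mul0r.
Qed.

Section Representations.
Variables (R : realType) (Q : quiver).
Local Notation C := R[i].

Definition rep (a : dimension Q) : Type :=
  forall e : arrow Q, 'M[C]_(a (qhead e), a (qtail e)).

Definition mxfamily (a : dimension Q) : Type :=
  forall x : vertex Q, 'M[C]_(a x).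

Definition in_GL (a : dimension Q) (g : mxfamily a) : Prop :=
  forall x, g x \in unitmx.

Definition GL_inv (a : dimension Q) (g : mxfamily a) : mxfamily a :=
  fun x => invmx (g x).

Definition rep_act (a : dimension Q) (g : mxfamily a) (V : rep a) : rep a :=
  fun e => g (qhead e) *m V e *m invmx (g (qtail e)).

Definition fun_act (a : dimension Q) (g : mxfamily a) (f : rep a -> C) :
    rep a -> C :=
  fun V => f (rep_act (GL_inv g) V).

Definition coord (a : dimension Q) : finType :=
  {e : arrow Q & 'I_(a (qhead e)) * 'I_(a (qtail e))}%type.

Definition coord_val (a : dimension Q) (V : rep a) (c : coord a) : C :=
  V (tag c) (tagged c).1 (tagged c).2.

Definition polynomial_function (a : dimension Q) (f : rep a -> C) : Prop :=
  exists p : {mpoly C[#|coord a|]},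
    forall V : rep a, f V = p.@[fun i => coord_val V (enum_val i)].

Definition chi (a : dimension Q) (s : weight Q) (g : mxfamily a) : C :=
  \prod_(x : vertex Q) (\det (g x)) ^ (s x).

Definition SI (a : dimension Q) (s : weight Q) (f : rep a -> C) : Prop :=
  polynomial_function f /\
  forall g : mxfamily a, in_GL g ->
    forall V : rep a, fun_act g f V = chi s g * f V.

Definition Sigma (a : dimension Q) (s : weight Q) : Prop :=
  exists2 f : rep a -> C, SI s f & exists V : rep a, f V != 0.

End Representations.

Arguments SI R {Q} a s f.
Arguments Sigma R {Q} a s.

(* Main.v *)
(** Work over the fraction field F of a polynomial ring over C, whose
    indeterminates are the entries of a universal representation A.  The field
    F has derivations with arbitrary prescribed values on those entries, and
    differentiating A i = i U shows that Ext(U, A/U) = 0 for every F-rational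
    subrepresentation U of A.

    Necessity.  The universal representation W of dimension alpha - beta is
    semistable for <beta, .>.  If Ext(B, W) were nonzero for the universal B,
    take f : B -> W of maximal rank, with kernel K, image I and cokernel D:
    then Ext(K, I) = Ext(I, D) = 0, Hom(K, D) = 0 and Ext(K, D) <> 0, so
    <K, D> < 0.  Killing the images of I in D yields a quotient D' of W with
    Hom(I, D') = 0 and <B, D'> < 0, a contradiction.  So Ext(B, W) = 0, a
    general representation of dimension alpha has a subrepresentation of
    dimension beta, and a one-parameter subgroup gives sigma(beta) <= 0.

    Sufficiency.  If A had subrepresentations with sigma > 0, the largest one
    U maximizing sigma would have Hom(U, A/U) = 0 = Ext(U, A/U), so the
    determinant of the map whose kernel and cokernel are Hom(U, -) and
    Ext(U, -) would put <U, .> in Sigma(alpha - U), against (2).  Hence A is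
    sigma-semistable, sigma agrees on the support of alpha with <beta, .> for
    some beta >= 0, and the argument above gives Hom(B, A) = Ext(B, A) = 0 for
    the universal B of dimension beta; the same determinant is then a nonzero
    semi-invariant of weight sigma. *)

Require Import Defs.
From mathcomp Require Import all_boot all_order all_algebra.
From mathcomp Require Import zify ring.
From mathcomp Require Import reals complex mpoly fraction boolp.

Set Implicit Arguments.
Unset Strict Implicit.
Unset Printing Implicit Defensive.

Import Order.TTheory GRing.Theory Num.Theory.
Local Open Scope ring_scope.

(** * Linear algebra *)

Section LinearAlgebra.

(** Sylvester's identity: both sides are the determinant of [M], which splits into block triangular
    factors through either diagonal block. *)
Lemma det_add1_mulC (R : comNzRingType) m n (A : 'M[R]_(m, n)) (B : 'M_(n, m)) :
  \det (1%:M + A *m B) = \det (1%:M + B *m A).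
Proof.
pose M := block_mx 1%:M (- A) B 1%:M.
have -> : \det (1%:M + A *m B) = \det M.
  have -> : M = block_mx (1%:M + A *m B) (- A) 0 1%:M *m block_mx 1%:M 0 B 1%:M.
    rewrite mulmx_block ?(mulmx1, mulmx0, mul0mx, mul1mx) !add0r mulNmx.
    by rewrite addrK.
  by rewrite det_mulmx det_ublock det_lblock !det1 !mulr1.
have -> : M = block_mx 1%:M 0 B 1%:M *m block_mx 1%:M (- A) 0 (1%:M + B *m A).
  rewrite mulmx_block ?(mulmx1, mulmx0, mul0mx, mul1mx) !addr0.
  by rewrite mulmxN addrCA addNr addr0.
by rewrite det_mulmx det_ublock det_lblock !det1 !mul1r.
Qed.

(** The blocks cut out by the pairs [V t], [U t] are mutually orthogonal, so the factors 1 + V t (g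
    t - 1) U t multiply without cross terms; by [det_add1_mulC] each has determinant
    [\det (g t)]. *)
Lemma det_add1_blocks (R : comNzRingType) (T : eqType) (n : T -> nat) N
    (U : forall t, 'M[R]_(n t, N)) (V : forall t, 'M[R]_(N, n t))
    (g : forall t, 'M[R]_(n t)) (s : seq T) :
  uniq s -> (forall t, U t *m V t = 1%:M) ->
  (forall t u, t != u -> U t *m V u = 0) ->
  \det (1%:M + \sum_(t <- s) V t *m (g t - 1%:M) *m U t)
    = \prod_(t <- s) \det (g t).
Proof.
move=> + UV1 UV0; elim: s => [|t s IHs] /=.
  by rewrite !big_nil addr0 det1.
case/andP=> ts us; rewrite !big_cons -(IHs us).
have -> : \det (g t) = \det (1%:M + V t *m ((g t - 1%:M) *m U t)).
  by rewrite det_add1_mulC -mulmxA UV1 mulmx1 addrC subrK.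
rewrite -det_mulmx mulmxA.
congr (\det _); set X := V t *m _ *m _; set S := \sum_(_ <- _) _.
have XS : X *m S = 0.
  rewrite mulmx_sumr big_seq big1 // => u us'.
  rewrite !mulmxA -[_ *m U t *m V u]mulmxA UV0 ?mulmx0 ?mul0mx //.
  by apply: contraNneq ts => ->.
by rewrite mulmxDl mul1mx mulmxDr mulmx1 XS addr0 -!addrA [S + X]addrC.
Qed.

Lemma rank_factor (F : fieldType) m n k (M : 'M[F]_(m, n)) :
  \rank M = k ->
  exists f : 'M_(m, k), exists f' : 'M_(k, m),
  exists g : 'M_(k, n), exists g' : 'M_(n, k),
  [/\ M = f *m g, f' *m f = 1%:M & g *m g' = 1%:M].
Proof.
move=> <-.
have /row_fullP[f' f'f] := col_base_full M.
have /row_freeP[g' gg'] := row_base_free M.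
by exists (col_base M), f', (row_base M), g'; rewrite mulmx_base.
Qed.

(** A biproduct decomposition: [i] and [s] include the two summands, [r] and [p] are the matching
    projections. *)
Definition split_seq (R : nzRingType) a b c (i : 'M[R]_(a, b)) (r : 'M_(b, a))
    (s : 'M_(a, c)) (p : 'M_(c, a)) : Prop :=
  [/\ r *m i = 1%:M, p *m s = 1%:M, p *m i = 0, r *m s = 0
     & i *m r + s *m p = 1%:M].

Lemma idem_factor (F : fieldType) a c (M : 'M[F]_a) :
  M *m M = M -> \rank M = c ->
  exists s : 'M_(a, c), exists p : 'M_(c, a), M = s *m p /\ p *m s = 1%:M.
Proof.
move=> MM /rank_factor[f [f' [g [g' [Mfg ff gg]]]]].
exists f, g; split=> //.
have : f' *m (M *m M) *m g' = f' *m M *m g' by rewrite MM.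
by rewrite Mfg !mulmxA ff !mul1mx -mulmxA gg mulmx1.
Qed.

Lemma rank_retract (F : fieldType) a b (i : 'M[F]_(a, b)) (r : 'M_(b, a)) :
  r *m i = 1%:M -> (b <= a)%N.
Proof.
move=> ri; have := mxrankM_maxl r i; rewrite ri mxrank1 => h.
exact: leq_trans h (rank_leq_col r).
Qed.

(** 1 - i r is an idempotent of rank a - b, and its rank factorization supplies the complement. *)
Lemma split_complement (F : fieldType) a b (i : 'M[F]_(a, b)) (r : 'M_(b, a)) :
  r *m i = 1%:M ->
  exists s : 'M_(a, a - b), exists p : 'M_(a - b, a), split_seq i r s p.
Proof.
move=> ri; pose P := i *m r; pose M := 1%:M - P.
have PP : P *m P = P by rewrite /P mulmxA -[i *m r *m i]mulmxA ri mulmx1.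
have PM : P *m M = 0 by rewrite mulmxBr mulmx1 PP subrr.
have MM : M *m M = M by rewrite {1}/M mulmxBl mul1mx PM subr0.
have rP : \rank P = b.
  apply/eqP; rewrite eqn_leq (leq_trans (mxrankM_maxl _ _) (rank_leq_col _)) /=.
  have : r *m P *m i = 1%:M by rewrite /P !mulmxA ri mul1mx ri.
  move=> /(congr1 (fun X => \rank X)); rewrite mxrank1 => {1}<-.
  exact: leq_trans (mxrankM_maxl _ _) (mxrankM_maxr _ _).
have rM : \rank M = (a - b)%N.
  have h1 := mulmx0_rank_max PM.
  have : (a <= \rank P + \rank M)%N.
    have := mxrank_add P M; rewrite /M addrC subrK mxrank1 //.
  by rewrite rP in h1 *; lia.
have [s [p [Msp ps]]] := idem_factor MM rM.
have pM : p *m M = p by rewrite Msp mulmxA ps mul1mx.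
have Ms : M *m s = s by rewrite Msp -mulmxA ps mulmx1.
exists s, p; split=> //.
- by rewrite -pM -mulmxA /M mulmxBl mul1mx /P -mulmxA ri mulmx1 subrr mulmx0.
- by rewrite -Ms mulmxA /M mulmxBr mulmx1 /P mulmxA ri mul1mx subrr mul0mx.
- by rewrite -Msp /M addrC subrK.
Qed.

Lemma split_swap (R : nzRingType) a b c (i : 'M[R]_(a, b)) r (s : 'M_(a, c)) p :
  split_seq i r s p -> split_seq s p i r.
Proof. by case=> h1 h2 h3 h4 h5; split=> //; rewrite addrC. Qed.

End LinearAlgebra.

(** * Families of matrices flattened into row vectors *)

Section Families.
Variables (T : finType) (p q : T -> nat).

Definition fam (R : Type) := forall t : T, 'M[R]_(p t, q t).
Definition idx : finType := {t : T & ('I_(p t) * 'I_(q t))%type}.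

Definition fam_vec (R : Type) (f : fam R) : 'rV[R]_#|idx| :=
  \row_c f (tag (enum_val c)) (tagged (enum_val c)).1 (tagged (enum_val c)).2.

Definition idx_rank (t : T) (i : 'I_(p t)) (j : 'I_(q t)) : 'I_#|idx| :=
  enum_rank (Tagged (fun t => ('I_(p t) * 'I_(q t))%type) (i, j) : idx).

Definition vec_fam (R : Type) (v : 'rV[R]_#|idx|) : fam R :=
  fun t => \matrix_(i, j) v 0 (idx_rank i j).

Lemma fam_vecK R (f : fam R) t : vec_fam (fam_vec f) t = f t.
Proof. by apply/matrixP=> i j; rewrite !mxE /idx_rank enum_rankK. Qed.

Lemma vec_famK R (v : 'rV[R]_#|idx|) : fam_vec (vec_fam v) = v.
Proof.
apply/rowP=> c; rewrite !mxE; congr (v 0 _); rewrite /idx_rank.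
by rewrite -[RHS]enum_valK; congr enum_rank; case: (enum_val c) => t [].
Qed.

Lemma eq_fam_vec R (f g : fam R) : (forall t, f t = g t) -> fam_vec f = fam_vec g.
Proof. by move=> fg; apply/rowP=> c; rewrite !mxE fg. Qed.

Lemma card_idx : #|idx| = (\sum_t p t * q t)%N.
Proof.
rewrite card_tagged sumnE big_map big_enum /=.
by apply: eq_bigr => t _; rewrite card_prod !card_ord.
Qed.

End Families.

Local Notation fam0 R a b := (@fam (vertex _) a b R).
Local Notation fam1 R a b :=
  (@fam (arrow _) (fun e => a (qhead e)) (fun e => b (qtail e)) R).

(** * Representations over a ring and the coboundary map *)

Section Representations.
Variable Q : quiver.

Definition mrep (R : Type) (a : dimension Q) : Type :=
  forall e : arrow Q, 'M[R]_(a (qhead e), a (qtail e)).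

Definition is_hom (R : nzRingType) (b a : dimension Q) (B : mrep R b) (A : mrep R a)
    (f : fam0 R a b) : Prop :=
  forall e, A e *m f (qtail e) = f (qhead e) *m B e.

(** This map has kernel Hom(B, A) and cokernel Ext(B, A), which is how both groups are handled
    throughout; [card_euler] gives the difference between the dimensions of its source and
    target. *)
Definition cobd (R : nzRingType) (b a : dimension Q) (B : mrep R b) (A : mrep R a)
    (f : fam0 R a b) : fam1 R a b :=
  fun e => A e *m f (qtail e) - f (qhead e) *m B e.

Definition hom_zero (R : nzRingType) (b a : dimension Q) (B : mrep R b) (A : mrep R a) :=
  forall f, is_hom B A f -> forall x, f x = 0.

Definition ext_zero (R : nzRingType) (b a : dimension Q) (B : mrep R b) (A : mrep R a) :=
  forall n : fam1 R a b, exists f, forall e, cobd B A f e = n e.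

Definition cobd_mx (R : nzRingType) (b a : dimension Q) (B : mrep R b) (A : mrep R a) :
   'M[R]_(#|idx (T := vertex Q) a b|,
          #|idx (T := arrow Q) (fun e => a (qhead e)) (fun e => b (qtail e))|) :=
  \matrix_(c, d) fam_vec (cobd B A (vec_fam (delta_mx 0 c))) 0 d.

Lemma cobd_mxE (R : comNzRingType) (b a : dimension Q) (B : mrep R b) (A : mrep R a)
   (v : 'rV_#|idx (T := vertex Q) a b|) :
  v *m cobd_mx B A = fam_vec (cobd B A (vec_fam v)).
Proof.
pose G w : 'rV_#|_| := fam_vec (cobd B A (vec_fam w)).
have vfD u w x : vec_fam (u + w) x = vec_fam (T := vertex Q) (p := a) (q := b) u x + vec_fam w x.
  by apply/matrixP=> i j; rewrite !mxE.
have vfZ c w x : vec_fam (c *: w) x = c *: vec_fam (T := vertex Q) (p := a) (q := b) w x.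
  by apply/matrixP=> i j; rewrite !mxE.
have GD u w : G (u + w) = G u + G w.
  apply/rowP=> d; rewrite [LHS]mxE [RHS]mxE /cobd !vfD mulmxDr mulmxDl opprD addrACA.
  by rewrite ![fam_vec _ _ _]mxE [LHS]mxE.
have GZ c w : G (c *: w) = c *: G w.
  apply/rowP=> d; rewrite [LHS]mxE [RHS]mxE /cobd !vfZ -scalemxAr -scalemxAl -scalerBr.
  by rewrite [fam_vec _ _ _]mxE [LHS]mxE.
have G0 : G 0 = 0 by rewrite -(scale0r 0) GZ !scale0r.
rewrite -[RHS]/(G v) [in RHS](row_sum_delta v) (big_morph G GD G0).
rewrite mulmx_sum_row; apply: eq_bigr => c _; rewrite GZ; congr (_ *: _).
by apply/rowP=> d; rewrite !mxE.
Qed.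

Lemma map_cobd_mx (R S : nzRingType) (h : {rmorphism R -> S}) (b a : dimension Q)
    (B : mrep R b) (A : mrep R a) :
  map_mx h (cobd_mx B A) =
  cobd_mx (fun e => map_mx h (B e) : 'M_(b (qhead e), b (qtail e)))
          (fun e => map_mx h (A e) : 'M_(a (qhead e), a (qtail e))).
Proof.
apply/matrixP=> c d; rewrite !mxE rmorphB !rmorph_sum /=.
by congr (_ - _); apply: eq_bigr => i _; rewrite !mxE rmorphM /= -!val_eqE /= rmorph_nat.
Qed.

Lemma card_euler (b a : dimension Q) :
  euler_form (dimZ b) (dimZ a) =
    (#|idx (T := vertex Q) a b|)%:Z
    - (#|idx (T := arrow Q) (fun e => a (qhead e)) (fun e => b (qtail e))|)%:Z.
Proof.
rewrite !card_idx /euler_form /dimZ; congr (_ - _).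
  by rewrite (big_morph Posz PoszD (erefl _)); apply: eq_bigr => x _; rewrite PoszM mulrC.
by rewrite (big_morph Posz PoszD (erefl _)); apply: eq_bigr => x _; rewrite PoszM mulrC.
Qed.

End Representations.

(** * Homomorphisms, extensions and exact sequences *)

Section EulerForm.
Variable Q : quiver.
Implicit Types (a b c : dimension Q).

Lemma euler_addl b b1 b2 c : (forall x, b x = b1 x + b2 x)%N ->
  euler_form (dimZ b) (dimZ c) =
  euler_form (dimZ b1) (dimZ c) + euler_form (dimZ b2) (dimZ c).
Proof.
move=> bE; rewrite /euler_form /dimZ addrACA -opprD -!big_split /=; congr (_ - _).
  by apply: eq_bigr => x _; rewrite bE PoszD mulrDl.
by apply: eq_bigr => x _; rewrite bE PoszD mulrDl.
Qed.

Lemma euler_addr b c c1 c2 : (forall x, c x = c1 x + c2 x)%N ->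
  euler_form (dimZ b) (dimZ c) =
  euler_form (dimZ b) (dimZ c1) + euler_form (dimZ b) (dimZ c2).
Proof.
move=> cE; rewrite /euler_form /dimZ addrACA -opprD -!big_split /=; congr (_ - _).
  by apply: eq_bigr => x _; rewrite cE PoszD mulrDr.
by apply: eq_bigr => x _; rewrite cE PoszD mulrDr.
Qed.

Lemma weight_add (s : weight Q) a b c : (forall x, a x = b x + c x)%N ->
  weight_eval s (dimZ a) = weight_eval s (dimZ b) + weight_eval s (dimZ c).
Proof.
move=> aE; rewrite /weight_eval /dimZ -big_split /=.
by apply: eq_bigr => x _; rewrite aE PoszD mulrDr.
Qed.

End EulerForm.

Section HomExt.
Variables (Q : quiver) (F : fieldType).
Implicit Types (a b c d : dimension Q).

Lemma hom_zeroP b a (B : mrep F b) (A : mrep F a) :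
  hom_zero B A <-> row_free (cobd_mx B A).
Proof.
split=> [h|/row_freeP[D' DD'] f hf x].
  apply: inj_row_free => v; rewrite cobd_mxE => v0.
  rewrite -[v]vec_famK -[RHS](vec_famK (0 : 'rV_#|_|)).
  apply: eq_fam_vec => x; rewrite h.
    by apply/matrixP=> i j; rewrite !mxE.
  move=> e; apply/eqP; rewrite -subr_eq0; apply/eqP.
  rewrite -/(cobd B A (vec_fam v) e) -[cobd _ _ _ _]fam_vecK v0.
  by apply/matrixP=> i j; rewrite !mxE.
have : fam_vec f *m cobd_mx B A = 0.
  rewrite cobd_mxE; apply/rowP=> c; rewrite !mxE /cobd.
  have e := hf (tag (enum_val c)).
  rewrite !fam_vecK; have := e => /eqP; rewrite -subr_eq0 => /eqP /matrixP.
  by move/(_ (tagged (enum_val c)).1 (tagged (enum_val c)).2); rewrite !mxE.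
move/(congr1 (fun M => M *m D')); rewrite -mulmxA DD' mulmx1 mul0mx => f0.
by rewrite -[f x]fam_vecK f0; apply/matrixP=> i j; rewrite !mxE.
Qed.

Lemma ext_zeroP b a (B : mrep F b) (A : mrep F a) :
  ext_zero B A <-> row_full (cobd_mx B A).
Proof.
split=> [h|/row_fullP[D' D'D] n].
  rewrite -sub1mx; apply/row_subP=> d.
  have [f hf] := h (vec_fam (row d 1%:M)).
  apply/submxP; exists (fam_vec f); rewrite cobd_mxE.
  rewrite -[LHS]vec_famK; apply: eq_fam_vec => e; rewrite -hf /cobd.
  by rewrite !fam_vecK.
exists (vec_fam (fam_vec n *m D')) => e.
rewrite -[LHS]fam_vecK -cobd_mxE -mulmxA D'D mulmx1.
by rewrite fam_vecK.
Qed.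

Lemma hom_zero_euler b a (B : mrep F b) (A : mrep F a) :
  hom_zero B A -> euler_form (dimZ b) (dimZ a) <= 0.
Proof.
move/hom_zeroP; rewrite /row_free => /eqP rD.
by rewrite card_euler subr_le0 lez_nat -rD rank_leq_col.
Qed.

Lemma ext_zero_euler b a (B : mrep F b) (A : mrep F a) :
  ext_zero B A -> 0 <= euler_form (dimZ b) (dimZ a).
Proof.
move/ext_zeroP; rewrite /row_full => /eqP rD.
by rewrite card_euler subr_ge0 lez_nat -rD rank_leq_row.
Qed.

(** When the Euler form vanishes the coboundary matrix has as many rows as columns, so injectivity
    and surjectivity coincide. *)
Lemma hom_ext_zero b a (B : mrep F b) (A : mrep F a) :
  euler_form (dimZ b) (dimZ a) = 0 -> hom_zero B A <-> ext_zero B A.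
Proof.
rewrite card_euler => /eqP; rewrite subr_eq0 => /eqP[e].
split=> [/hom_zeroP|/ext_zeroP] h; [apply/ext_zeroP|apply/hom_zeroP].
  by rewrite /row_full (eqP h) e.
by rewrite /row_free (eqP h) e.
Qed.

Lemma hom_zero_ext_nonzero b a (B : mrep F b) (A : mrep F a) :
  hom_zero B A -> ~ ext_zero B A -> euler_form (dimZ b) (dimZ a) < 0.
Proof.
move=> h nh; rewrite lt_neqAle (hom_zero_euler h) andbT.
by apply/eqP => /(hom_ext_zero B A) e; apply/nh/e.
Qed.

(* Split exact sequence 0 -> U -> A -> C -> 0; [r] and [s] split it as
   vector spaces only. *)
Definition ses u a c (U : mrep F u) (A : mrep F a) (C : mrep F c)
    (i : fam0 F a u) (r : fam0 F u a) (s : fam0 F a c) (p : fam0 F c a) : Prop :=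
  [/\ is_hom U A i, is_hom A C p
    & forall x, split_seq (i x) (r x) (s x) (p x)].

Definition is_quot a c (A : mrep F a) (C : mrep F c) : Prop :=
  exists p : fam0 F c a, exists s : fam0 F a c,
    is_hom A C p /\ forall x, p x *m s x = 1%:M.

Definition is_sub u a (U : mrep F u) (A : mrep F a) : Prop :=
  exists i : fam0 F a u, exists r : fam0 F u a,
    is_hom U A i /\ forall x, r x *m i x = 1%:M.

Lemma hom_comp a b c (A : mrep F a) (B : mrep F b) (C : mrep F c)
    (f : fam0 F b a) (g : fam0 F c b) :
  is_hom A B f -> is_hom B C g -> is_hom A C (fun x => g x *m f x).
Proof. by move=> hf hg e; rewrite mulmxA hg -mulmxA hf mulmxA. Qed.

Lemma quot_trans a b c (A : mrep F a) (B : mrep F b) (C : mrep F c) :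
  is_quot A B -> is_quot B C -> is_quot A C.
Proof.
move=> [p [s [hp ps]]] [p' [s' [hp' ps']]].
exists (fun x => p' x *m p x), (fun x => s x *m s' x); split.
  exact: hom_comp hp hp'.
by move=> x; rewrite mulmxA -[_ *m p x *m s x]mulmxA ps mulmx1.
Qed.

Lemma quot_refl a (A : mrep F a) : is_quot A A.
Proof.
exists (fun x => 1%:M), (fun x => 1%:M); split=> [e|x]; last by rewrite mulmx1.
by rewrite mulmx1 mul1mx.
Qed.

Lemma sub_trans a b c (A : mrep F a) (B : mrep F b) (C : mrep F c) :
  is_sub A B -> is_sub B C -> is_sub A C.
Proof.
move=> [i [r [hi ri]]] [i' [r' [hi' ri']]].
exists (fun x => i' x *m i x), (fun x => r x *m r' x); split.
  exact: hom_comp hi hi'.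
by move=> x; rewrite mulmxA -[_ *m r' x *m i' x]mulmxA ri' mulmx1.
Qed.

Lemma ses_dim u a c (U : mrep F u) (A : mrep F a) (C : mrep F c) i r s p :
  ses U A C i r s p -> forall x, a x = (u x + c x)%N.
Proof.
case=> _ _ h x; have [ri ps pi0 rs0 e1] := h x.
have hr : \rank (row_mx (i x) (s x)) = (u x + c x)%N.
  apply/eqP; rewrite eqn_leq rank_leq_col /=.
  have := mxrankM_maxr (col_mx (r x) (p x)) (row_mx (i x) (s x)).
  by rewrite mul_col_row ri ps pi0 rs0 -scalar_mx_block mxrank1.
apply/eqP; rewrite eqn_leq -{2}hr rank_leq_row andbT.
have := mxrankM_maxl (row_mx (i x) (s x)) (col_mx (r x) (p x)).
by rewrite mul_row_col e1 mxrank1 hr.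
Qed.

Lemma sub_ses u a (U : mrep F u) (A : mrep F a) (i : fam0 F a u) r :
  is_hom U A i -> (forall x, r x *m i x = 1%:M) ->
  exists C : mrep F (dim_sub a u), exists s p, ses U A C i r s p.
Proof.
move=> hi ri.
have [s hs] := fin_all_exists (fun x => split_complement (ri x)).
have [p hp] := fin_all_exists hs.
exists (fun e => p (qhead e) *m A e *m s (qtail e)), s, p; split=> // e.
have [_ _ pi0 _ _] := hp (qhead e); have [_ _ _ _ e1] := hp (qtail e).
rewrite -[LHS]mulmxA; have -> : s (qtail e) *m p (qtail e) = 1%:M - i (qtail e) *m r (qtail e).
  by rewrite -e1 [X in X - _]addrC addrK.
by rewrite mulmxBr mulmx1 mulmxA -[_ *m A e *m i _]mulmxA hi !mulmxA pi0 !mul0mx subr0.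
Qed.

Lemma quot_ses a c (A : mrep F a) (C : mrep F c) (p : fam0 F c a) s :
  is_hom A C p -> (forall x, p x *m s x = 1%:M) ->
  exists U : mrep F (dim_sub a c), exists i r, ses U A C i r s p.
Proof.
move=> hp ps.
have [i hi] := fin_all_exists (fun x => split_complement (ps x)).
have [r hr] := fin_all_exists hi.
exists (fun e => r (qhead e) *m A e *m i (qtail e)), i, r; split=> //.
  move=> e; have [_ _ rs0 pi0 e1] := hr (qhead e).
  have [_ _ _ pi0' _] := hr (qtail e).
  rewrite !mulmxA; have -> : i (qhead e) *m r (qhead e) = 1%:M - s (qhead e) *m p (qhead e).
    by rewrite -e1 [X in X - _]addrC addrK.
  rewrite mulmxBl mul1mx mulmxBl -!mulmxA [p _ *m (_ *m _)]mulmxA -hp.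
  by rewrite -mulmxA pi0' !mulmx0 subr0.
by move=> x; exact/split_swap/hr.
Qed.

Lemma ses_sub u a c (U : mrep F u) (A : mrep F a) (C : mrep F c) i r s p :
  ses U A C i r s p -> is_sub U A.
Proof. by case=> hi hp h; exists i, r; split=> // x; case: (h x). Qed.

Lemma ses_quot u a c (U : mrep F u) (A : mrep F a) (C : mrep F c) i r s p :
  ses U A C i r s p -> is_quot A C.
Proof. by case=> hi hp h; exists p, s; split=> // x; case: (h x). Qed.

Lemma image_factor b a (B : mrep F b) (A : mrep F a) (f : fam0 F a b) j :
  is_hom B A f -> (forall x, \rank (f x) = j x) ->
  exists I : mrep F j, exists i p,
    [/\ is_hom I A i, is_hom B I p, forall x, f x = i x *m p x,
        exists r : fam0 F _ _, forall x, r x *m i x = 1%:M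
      & exists s : fam0 F _ _, forall x, p x *m s x = 1%:M].
Proof.
move=> hf rf.
have [i /fin_all_exists[r /fin_all_exists[p /fin_all_exists[s h]]]] :=
  fin_all_exists (fun x => rank_factor (rf x)).
have fE x : f x = i x *m p x by case: (h x).
have ri x : r x *m i x = 1%:M by case: (h x).
have ps x : p x *m s x = 1%:M by case: (h x).
pose I : mrep F j :=
  fun e => p (qhead e) *m B e *m s (qtail e).
have hi : is_hom I A i.
  move=> e; rewrite /I !mulmxA -fE -hf fE -!mulmxA ps mulmx1 //.
exists I, i, p; split=> //; [|by exists r|by exists s].
move=> e; have := hf e; rewrite !fE mulmxA hi => /(congr1 (mulmx (r (qhead e)))).
by rewrite !mulmxA ri !mul1mx.
Qed.

(** Right exactness of Ext(B, -): lift the cochain through the vertexwise section, solve in [C],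
    then project. *)
Lemma ext_zero_quotr b c d (B : mrep F b) (C : mrep F c) (D : mrep F d) :
  ext_zero B C -> is_quot C D -> ext_zero B D.
Proof.
move=> h [p [s [hp ps]]] n; have [f hf] := h (fun e => s (qhead e) *m n e).
exists (fun x => p x *m f x) => e; rewrite /cobd mulmxA hp -!mulmxA -mulmxBr.
by rewrite -/(cobd B C f e) hf mulmxA ps mul1mx.
Qed.

(** While a nonzero map from [B] remains, pass to its cokernel; the total dimension drops, so this
    stops. [P] is an invariant carried along these steps. *)
Lemma kill_images b c (B : mrep F b) (C : mrep F c)
    (P : forall d, mrep F d -> Prop) :
  P c C ->
  (forall d (D : mrep F d) j (J : mrep F j) d' (D' : mrep F d') i r s p,
     P d D -> is_quot B J -> ses J D D' i r s p -> P d' D') ->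
  exists d, exists D : mrep F d, [/\ is_quot C D, P d D & hom_zero B D].
Proof.
move=> PC Pstep; have [m] := ubnP (\sum_x c x)%N.
elim: m => // m IHm in c C PC * => /ltnSE lem.
have [h|nh] := EM (hom_zero B C); first by exists c, C; split=> //; exact: quot_refl.
have [f [hf [x fx]]] : exists f, is_hom B C f /\ exists x, f x <> 0.
  apply: contrapT => nf; apply: nh => f hf x.
  by apply: contrapT => fx; apply: nf; exists f; split=> //; exists x.
have [J [i [p [hi hp fE [r ri] [s ps]]]]]  := image_factor hf (fun x => erefl).
have [D [s' [p' hses]]] := sub_ses hi ri.
have PD : P _ D by apply: Pstep PC _ hses; exists p, s.
have lt : (\sum_x dim_sub c (fun x => \rank (f x)) x < m)%N.
  apply: leq_trans lem; rewrite [X in (_ < X)%N](bigD1 x) //= (bigD1 x) //= -addSn leq_add //.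
    have : (0 < \rank (f x))%N by rewrite lt0n mxrank_eq0; apply/eqP.
    by move: (rank_leq_row (f x)); rewrite /dim_sub; lia.
  by apply: leq_sum => y _; exact: leq_subr.
have [d [E [qDE PE hE]]] := IHm _ D PD lt.
exists d, E; split=> //; exact: quot_trans (ses_quot hses) qDE.
Qed.

End HomExt.

(** * Generic ranks and derivations *)

Section RankPencils.
Variable F : fieldType.

Lemma det_pencil n (M N : 'M[F]_n) : \det M != 0 ->
  exists2 P : {poly F}, P != 0 & forall t, P.[t] = \det (M + t *: N).
Proof.
move=> M0; pose P : {poly F} := \det (map_mx polyC M + 'X *: map_mx polyC N).
have PE t : P.[t] = \det (M + t *: N).
  rewrite -/(horner_eval t P) /P -det_map_mx; congr (\det _).
  by apply/matrixP=> i j; rewrite !mxE /= horner_evalE !hornerE.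
exists P; last exact: PE.
apply: contraNneq M0 => P0; by rewrite -[M]addr0 -(scale0r N) -PE P0 horner0.
Qed.

(** Compressing [M] by one-sided inverses of its rank factors gives the identity, so the determinant
    of the compressed pencil is a nonzero polynomial in t; its non-roots are values where the rank
    has not dropped. *)
Lemma rank_pencil m n (M N : 'M[F]_(m, n)) :
  exists2 P : {poly F}, P != 0 &
    forall t, P.[t] != 0 -> (\rank M <= \rank (M + t *: N)%R)%N.
Proof.
have [k rM] : exists k : nat, \rank M = k by exists (\rank M).
have [f [f' [g [g' [Mfg ff gg]]]]] := rank_factor rM.
have M1 : f' *m M *m g' = 1%:M.
  by move: Mfg => /(congr1 (fun X => f' *m X *m g')) ->; rewrite mulmxA ff mul1mx.
have [|P P0 PE] := @det_pencil _ (f' *m M *m g') (f' *m N *m g').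
  by rewrite M1 det1 oner_neq0.
exists P; first by []. move=> t; rewrite PE -unitfE -[_ \is a _]/(_ \in unitmx) => /mxrank_unit rk.
rewrite rM -[X in (X <= _)%N]rk.
rewrite scalemxAl scalemxAr -mulmxDl -mulmxDr.
by apply: leq_trans (mxrankM_maxl _ _) _; exact: mxrankM_maxr.
Qed.

(** Border the compression of [rank_pencil] by the row [u] and the column [v]. The last column of
    the result is divisible by t; after division one gets [M0 + t *: N0], whose determinant at t = 0
    is u N v. *)
Lemma rank_pencil_lt m n (M N : 'M[F]_(m, n)) (u : 'rV_m) (v : 'cV_n) :
  u *m M = 0 -> M *m v = 0 -> u *m N *m v != 0 ->
  exists2 P : {poly F}, P != 0 &
    forall t, P.[t] != 0 -> (\rank M < \rank (M + t *: N)%R)%N.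
Proof.
move=> uM Mv uNv.
have [k rM] : exists k : nat, \rank M = k by exists (\rank M).
have [f [f' [g [g' [Mfg ff gg]]]]] := rank_factor rM.
have M1 : f' *m M *m g' = 1%:M.
  by move: Mfg => /(congr1 (fun X => f' *m X *m g')) ->; rewrite mulmxA ff mul1mx.
pose M0 := block_mx 1%:M (f' *m N *m v) 0 (u *m N *m v).
pose N0 : 'M_(k + 1) := block_mx (f' *m N *m g') 0 (u *m N *m g') 0.
have [|P P0 PE] := @det_pencil _ M0 N0.
  rewrite det_ublock det1 mul1r det_mx11.
  by apply: contra uNv => /eqP h; apply/eqP/matrixP=> i j; rewrite !ord1 h mxE.
(* The factor ['X] excludes t = 0, where the undivided last column is zero. *)
exists ('X * P); first by rewrite mulf_neq0 // polyX_eq0.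
move=> t; rewrite hornerM hornerX mulf_eq0 negb_or PE => /andP[t0 d0].
have : \rank ((M0 + t *: N0) *m block_mx 1%:M 0 0 t%:M)%R = (k + 1)%N.
  apply: mxrank_unit; rewrite unitmxE det_mulmx det_ublock det1 det_scalar1 mul1r.
  by rewrite unitfE mulf_neq0.
have -> : (M0 + t *: N0) *m block_mx 1%:M 0 0 t%:M =
    col_mx f' u *m (M + t *: N) *m row_mx g' v.
  rewrite /M0 /N0 scale_block_mx add_block_mx mulmx_block.
  rewrite !mulmx1 !mulmx0 !scaler0 !addr0 !add0r !mul_mx_scalar.
  rewrite mul_col_mx mul_col_row !mulmxDr !mulmxDl -!scalemxAr -!scalemxAl.
  by rewrite uM !mul0mx -[f' *m M *m v]mulmxA Mv mulmx0 M1 !add0r.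
move=> rk; rewrite rM -addn1 -[X in (X <= _)%N]rk.
by apply: leq_trans (mxrankM_maxl _ _) _; exact: mxrankM_maxr.
Qed.

Hypothesis F0 : [pchar F] =i pred0.

Lemma poly_nat_nonroot (P : {poly F}) : P != 0 -> exists n : nat, P.[n%:R] != 0.
Proof.
move=> P0; apply: contrapT => h.
have inj : injective (fun n : nat => n%:R : F).
  have w m n : (m <= n)%N -> m%:R = n%:R :> F -> m = n.
    move=> mn /esym/eqP; rewrite -subr_eq0 -natrB // ((pcharf0P F).1 F0) subn_eq0 => nm.
    by apply/eqP; rewrite eqn_leq mn.
  move=> m n; case/orP: (leq_total m n) => mn; first exact: w.
  by move=> /esym /w ->.
have := max_poly_roots (rs := [seq n%:R | n <- iota 0 (size P)]) P0.
rewrite size_map size_iota ltnn => /(_ _ _)/negP; case=> //.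
  by apply/allP=> _ /mapP[n _ ->]; apply/rootP; apply: contrapT => /eqP; move=> ?; apply: h; exists n.
by rewrite map_inj_uniq ?iota_uniq.
Qed.

(** First-order condition for maximal total rank: were u g v nonzero, then for a suitable n the rank
    at [x] would grow while no other rank drops. *)
Lemma max_rank_pencil (T : finType) (p q : T -> nat) (f g : fam p q F) :
  (forall n : nat, \sum_x \rank (f x + n%:R *: g x)%R <= \sum_x \rank (f x))%N ->
  forall x k l (u : 'M_(k, p x)) (v : 'M_(q x, l)),
  u *m f x = 0 -> f x *m v = 0 -> u *m g x *m v = 0.
Proof.
move=> fmax x k l u v uf fv; apply/matrixP=> i j; rewrite [RHS]mxE.
apply/eqP; apply: contrapT => /negP uv0.
have [||| P0 P00 hP0] := @rank_pencil_lt _ _ (f x) (g x) (row i u) (col j v).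
- by rewrite -row_mul uf row0.
- apply/matrixP=> a b; move/matrixP/(_ a j): fv; rewrite !mxE => fv.
  by rewrite -[RHS]fv; apply: eq_bigr => c _; rewrite !mxE.
- apply: contra uv0 => /eqP/matrixP/(_ 0 0); rewrite -row_mul !mxE => e.
  by apply/eqP; rewrite -[RHS]e; apply: eq_bigr => a _; rewrite !mxE.
have /fin_all_exists2[P P_0 hP] := fun y => rank_pencil (f y) (g y).
have [|n] := @poly_nat_nonroot (P0 * \prod_y P y).
  by rewrite mulf_neq0 //; apply/prodf_neq0.
rewrite hornerM mulf_eq0 negb_or horner_prod => /andP[n0 /prodf_neq0 ny].
have := fmax n; rewrite leqNgt => /negP; apply.
rewrite [X in (X < _)%N](bigD1 x) //= [X in (_ < X)%N](bigD1 x) //= -addSn leq_add //.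
  exact: hP0.
by apply: leq_sum => y _; apply: hP; exact: ny.
Qed.

End RankPencils.

Section Derivations.
Variable F : fieldType.

Definition derivation (D : F -> F) : Prop :=
  (forall x y, D (x + y) = D x + D y) /\ (forall x y, D (x * y) = D x * y + x * D y).

Variable D : F -> F.
Hypothesis derD : derivation D.

Lemma derivation0 : D 0 = 0.
Proof.
case: derD => Dd _; have := Dd 0 0; rewrite addr0 => /eqP.
by rewrite -subr_eq subrr => /eqP <-.
Qed.

Lemma map_derivation0 m n : map_mx D 0 = 0 :> 'M_(m, n).
Proof. by apply/matrixP=> i j; rewrite !mxE derivation0. Qed.

Lemma map_derivationM m n p (A : 'M_(m, n)) (B : 'M_(n, p)) :
  map_mx D (A *m B) = map_mx D A *m B + A *m map_mx D B.
Proof.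
case: derD => Dd DM; apply/matrixP=> i j; rewrite !mxE.
rewrite (big_morph D Dd derivation0) -big_split /=.
by apply: eq_bigr => k _; rewrite DM !mxE.
Qed.

End Derivations.

Section GenericRepresentations.
Variables (Q : quiver) (F : fieldType).
Implicit Types (a b c d : dimension Q).

(** Infinitesimal form of genericity: every tangent vector at [A] is realized by a derivation of the
    ground field. *)
Definition generic_rep a (A : mrep F a) : Prop :=
  forall n : mrep F a, exists2 D, derivation D & forall e, map_mx D (A e) = n e.

(* Applying a derivation D to A i = i U shows that the class of p D(A) i in
   Ext(U, C) vanishes, and D(A) is arbitrary. *)
Lemma generic_ses_ext_zero u a c (U : mrep F u) (A : mrep F a) (C : mrep F c) i r s p :
  generic_rep A -> ses U A C i r s p -> ext_zero U C.
Proof.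
move=> gA [hi hp h] n.
have [D dD DA] := gA (fun e => s (qhead e) *m n e *m r (qtail e)).
exists (fun x => - (p x *m map_mx D (i x))) => e.
have [ri _ _ _ _] := h (qtail e); have [_ ps pi0 _ _] := h (qhead e).
have := congr1 (fun M => p (qhead e) *m map_mx D M) (hi e).
rewrite /cobd !(map_derivationM dD) DA !mulmxDr !mulmxA ps mul1mx pi0 mul0mx addr0.
rewrite -mulmxA ri mulmx1 -hp => E.
by rewrite mulmxN mulNmx opprK addrC -E mulmxA addrK.
Qed.

Definition generic_pair b a (B : mrep F b) (A : mrep F a) : Prop :=
  forall (m : mrep F b) (n : mrep F a), exists2 D, derivation D &
    (forall e, map_mx D (B e) = m e) /\ (forall e, map_mx D (A e) = n e).

Lemma generic_pairl b a (B : mrep F b) (A : mrep F a) :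
  generic_pair B A -> generic_rep B.
Proof. by move=> g m; have [D dD [DB _]] := g m (fun e => 0); exists D. Qed.

Lemma generic_pairr b a (B : mrep F b) (A : mrep F a) :
  generic_pair B A -> generic_rep A.
Proof. by move=> g n; have [D dD [_ DA]] := g (fun e => 0) n; exists D. Qed.

End GenericRepresentations.

(** * Vanishing of Ext for generic pairs *)

Section GenericVanishing.
Variables (Q : quiver) (F : fieldType).
Implicit Types (a b c d : dimension Q).

Lemma cobdD b a (B : mrep F b) (A : mrep F a) f g e :
  cobd B A (fun x => f x + g x) e = cobd B A f e + cobd B A g e.
Proof. by rewrite /cobd mulmxDr mulmxDl opprD addrACA. Qed.

Lemma is_hom_cobd b a (B : mrep F b) (A : mrep F a) f :
  is_hom B A f <-> forall e, cobd B A f e = 0.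
Proof.
split=> h e; first by rewrite /cobd h subrr.
by apply/eqP; rewrite -subr_eq0 -/(cobd B A f e) h.
Qed.

Section ImageOfGenericHom.
Variables (b a k j c : dimension Q).
Variables (B : mrep F b) (A : mrep F a) (K : mrep F k) (I : mrep F j) (C : mrep F c).
Variables (iK : fam0 F b k) (rK : fam0 F k b) (sI : fam0 F b j) (pI : fam0 F j b).
Variables (iI : fam0 F a j) (rI : fam0 F j a) (sC : fam0 F a c) (pC : fam0 F c a).
Hypothesis genBA : generic_pair B A.
Hypothesis sesB : ses K B I iK rK sI pI.
Hypothesis sesA : ses I A C iI rI sC pC.

Let extKI : ext_zero K I := generic_ses_ext_zero (generic_pairl genBA) sesB.
Let extIC : ext_zero I C := generic_ses_ext_zero (generic_pairr genBA) sesA.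

Let hiK : is_hom K B iK. Proof. by case: sesB. Qed.
Let hpI : is_hom B I pI. Proof. by case: sesB. Qed.
Let hiI : is_hom I A iI. Proof. by case: sesA. Qed.
Let hpC : is_hom A C pC. Proof. by case: sesA. Qed.
Let rKiK x : rK x *m iK x = 1%:M. Proof. by case: sesB => _ _ /(_ x)[]. Qed.
Let pIsI x : pI x *m sI x = 1%:M. Proof. by case: sesB => _ _ /(_ x)[]. Qed.
Let pIiK x : pI x *m iK x = 0. Proof. by case: sesB => _ _ /(_ x)[]. Qed.
Let oneB x : iK x *m rK x + sI x *m pI x = 1%:M.
Proof. by case: sesB => _ _ /(_ x)[]. Qed.
Let rIiI x : rI x *m iI x = 1%:M. Proof. by case: sesA => _ _ /(_ x)[]. Qed.
Let pCsC x : pC x *m sC x = 1%:M. Proof. by case: sesA => _ _ /(_ x)[]. Qed.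
Let pCiI x : pC x *m iI x = 0. Proof. by case: sesA => _ _ /(_ x)[]. Qed.
Let oneA x : iI x *m rI x + sC x *m pC x = 1%:M.
Proof. by case: sesA => _ _ /(_ x)[]. Qed.

Let phi x := iI x *m pI x.

(** Ext(B, I) -> Ext(B, A) is zero: differentiate A phi = phi B along a derivation with D(A) = 0 and
    D(B) = sI n. Differentiating phi iK = 0 shows that D(phi) carries the kernel of phi into its
    image. *)
Let lift_phi (n : fam1 F j b) : exists f : fam0 F a b,
  (forall e, cobd B A f e = iI (qhead e) *m n e) /\
  (forall x, pC x *m f x *m iK x = 0).
Proof.
have [D dD [DB DA]] := genBA (fun e => sI (qhead e) *m n e) (fun e => 0).
exists (fun x => map_mx D (phi x)); split=> [e|x].
  have hphi : is_hom B A phi := hom_comp hpI hiI.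
  have := congr1 (map_mx D) (hphi e).
  rewrite (map_derivationM dD (A e)) (map_derivationM dD (phi (qhead e))).
  rewrite DA DB mul0mx add0r /cobd => ->.
  by rewrite [_ + phi _ *m _]addrC addrK /phi mulmxA -[_ *m pI _ *m sI _]mulmxA pIsI mulmx1.
have phik : phi x *m iK x = 0 by rewrite -mulmxA pIiK mulmx0.
have := congr1 (map_mx D) phik.
rewrite (map_derivation0 dD) (map_derivationM dD (phi x)).
move/(congr1 (mulmx (pC x))); rewrite mulmx0 mulmxDr mulmxA => <-.
by rewrite /phi !mulmxA pCiI !mul0mx addr0.
Qed.

(** A cochain [n] is corrected by coboundaries that successively remove its components from K to C,
    from K to I and from I to C, using the three vanishing Ext groups. What remains takes values in
    I, and [lift_phi] makes it a coboundary. *)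
Lemma kernel_ext_zero : ext_zero K C -> ext_zero B A.
Proof.
move=> extKC n.
have [f1 h1] := extKC (fun e => pC (qhead e) *m n e *m iK (qtail e)).
pose g1 x := sC x *m f1 x *m rK x; have [n1 n1E] : exists n1 : fam1 F a b, forall e, n1 e = n e - cobd B A g1 e.
  by exists (fun e => n e - cobd B A g1 e).
have pn1k e : pC (qhead e) *m n1 e *m iK (qtail e) = 0.
  rewrite n1E mulmxBr mulmxBl -h1 /cobd /g1 mulmxBr mulmxBl !mulmxA.
  rewrite -hpC -[C e *m pC _ *m sC _]mulmxA !pCsC mulmx1 mul1mx.
  rewrite -[_ *m rK _ *m iK _]mulmxA rKiK mulmx1.
  by rewrite -[_ *m B e *m _]mulmxA hiK mulmxA -[_ *m rK _ *m iK _]mulmxA rKiK mulmx1 subrr.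
have [f2 h2] := extKI (fun e => rI (qhead e) *m n1 e *m iK (qtail e)).
pose g2 x := iI x *m f2 x *m rK x; have [n2 n2E] : exists n2 : fam1 F a b, forall e, n2 e = n1 e - cobd B A g2 e.
  by exists (fun e => n1 e - cobd B A g2 e).
have n2k e : n2 e *m iK (qtail e) = 0.
  have -> : n2 e *m iK (qtail e) =
      n1 e *m iK (qtail e) - iI (qhead e) *m cobd K I f2 e.
    rewrite n2E mulmxBl /cobd /g2 mulmxBl mulmxBr !mulmxA hiI; congr (_ - (_ - _)).
      by rewrite -[_ *m rK _ *m iK _]mulmxA rKiK mulmx1.
    by rewrite -[_ *m B e *m _]mulmxA hiK mulmxA -[_ *m rK _ *m iK _]mulmxA rKiK mulmx1.
  rewrite h2 -[X in X - _]mul1mx -oneA mulmxDl !mulmxA addrC addKr.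
  by rewrite -mulmxA -[sC _ *m pC _ *m _]mulmxA mulmxA -!mulmxA [pC _ *m _]mulmxA pn1k mulmx0.
have n2S e : n2 e = n2 e *m sI (qtail e) *m pI (qtail e).
  by rewrite -[LHS]mulmx1 -oneB mulmxDr mulmxA n2k mul0mx add0r mulmxA.
have [f3 h3] := extIC (fun e => pC (qhead e) *m n2 e *m sI (qtail e)).
pose g3 x := sC x *m f3 x *m pI x; have [n3 n3E] : exists n3 : fam1 F a b, forall e, n3 e = n2 e - cobd B A g3 e.
  by exists (fun e => n2 e - cobd B A g3 e).
have pn3 e : pC (qhead e) *m n3 e = 0.
  have -> : pC (qhead e) *m n3 e =
      pC (qhead e) *m n2 e - cobd I C f3 e *m pI (qtail e).
    rewrite n3E mulmxBr /cobd /g3 mulmxBr mulmxBl !mulmxA -hpC pCsC mul1mx.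
    by rewrite -[C e *m pC _ *m sC _]mulmxA pCsC mulmx1 -[_ *m B e]mulmxA -hpI mulmxA.
  by rewrite h3 [n2 e in X in X - _]n2S !mulmxA subrr.
have n3S e : n3 e = iI (qhead e) *m (rI (qhead e) *m n3 e).
  by rewrite -[LHS]mul1mx -oneA mulmxDl -mulmxA -[sC _ *m _ *m _]mulmxA pn3 mulmx0 addr0.
have [f [hf _]] := lift_phi (fun e => rI (qhead e) *m n3 e).
exists (fun x => g1 x + (g2 x + (g3 x + f x))) => e.
rewrite !cobdD hf -n3S n3E n2E n1E.
by rewrite [cobd _ _ g3 e + _]addrC subrK [cobd _ _ g2 e + _]addrC subrK addrC subrK.
Qed.

(** A map [eta] from K to C extends to B because Ext(I, C) = 0, and the extension lifts to A because
    Ext(B, I) -> Ext(B, A) is zero. So [eta] is the component from K to C of a morphism B -> A,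
    which is zero by hypothesis. *)
Lemma kernel_hom_zero :
  (forall f, is_hom B A f -> forall x, pC x *m f x *m iK x = 0) -> hom_zero K C.
Proof.
move=> hmax eta heta x.
(* [th0] extends [eta] only linearly; its coboundary vanishes on K, hence factors through [pI] as
   the obstruction [m] in Ext(I, C). *)
pose th0 x := eta x *m rK x; pose m e := cobd B C th0 e *m sI (qtail e).
have mE e : cobd B C th0 e = m e *m pI (qtail e).
  rewrite -[LHS]mulmx1 -oneB mulmxDr !mulmxA.
  have -> : cobd B C th0 e *m iK (qtail e) = 0; last by rewrite mul0mx add0r.
  rewrite /cobd /th0 mulmxBl !mulmxA -[_ *m rK _ *m iK _]mulmxA rKiK mulmx1 heta.
  by rewrite -[_ *m B e *m _]mulmxA hiK mulmxA -[_ *m rK _ *m iK _]mulmxA rKiK mulmx1 subrr.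
have [psi hpsi] := extIC m.
pose th x := th0 x - psi x *m pI x.
have hth : is_hom B C th.
  apply/is_hom_cobd => e; have -> : cobd B C th e =
      cobd B C th0 e - cobd I C psi e *m pI (qtail e).
    rewrite /cobd /th mulmxBr !mulmxBl !mulmxA -[_ *m pI _ *m B e]mulmxA -hpI mulmxA.
    by rewrite !opprB addrACA [RHS]addrACA; congr (_ + _); rewrite addrC.
  by rewrite hpsi mE subrr.
have thk y : th y *m iK y = eta y.
  by rewrite mulmxBl -!mulmxA rKiK pIiK !mulmx1 mulmx0 subr0.
pose psi0 x := sC x *m th x.
have psi0E e : cobd B A psi0 e = iI (qhead e) *m (rI (qhead e) *m cobd B A psi0 e).
  rewrite -[LHS]mul1mx -oneA mulmxDl -!mulmxA.
  have -> : pC (qhead e) *m cobd B A psi0 e = 0; last by rewrite mulmx0 addr0.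
  rewrite /cobd /psi0 mulmxBr !mulmxA -hpC pCsC mul1mx.
  by rewrite -[C e *m _ *m _]mulmxA pCsC mulmx1 hth subrr.
have [f [hf pfk]] := lift_phi (fun e => rI (qhead e) *m cobd B A psi0 e).
have hchi : is_hom B A (fun x => psi0 x - f x).
  apply/is_hom_cobd => e; have -> : cobd B A (fun x => psi0 x - f x) e =
      cobd B A psi0 e - cobd B A f e.
    by rewrite /cobd mulmxBr mulmxBl !opprB addrACA [RHS]addrACA; congr (_ + _); rewrite addrC.
  by rewrite hf -psi0E subrr.
have := hmax _ hchi x; rewrite mulmxBr mulmxBl pfk subr0 /psi0.
by rewrite mulmxA pCsC mul1mx thk.
Qed.

End ImageOfGenericHom.

Lemma generic_pair_ext_zero b a (B : mrep F b) (A : mrep F a) :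
  [pchar F] =i pred0 -> generic_pair B A ->
  (forall c (C : mrep F c), is_quot A C -> 0 <= euler_form (dimZ b) (dimZ c)) ->
  ext_zero B A.
Proof.
move=> F0 genBA semi; apply: contrapT => next.
pose P m := `[< exists2 f, is_hom B A f & (\sum_x \rank (f x))%N = m >].
have exP : exists m, P m.
  exists 0%N; apply/asboolP; exists (fun x => 0) => [e|].
    by rewrite mulmx0 mul0mx.
  by rewrite big1 // => x _; rewrite mxrank0.
have ubP m : P m -> (m <= \sum_x a x)%N.
  by case/asboolP=> f _ <-; apply: leq_sum => x _; exact: rank_leq_row.
case: (ex_maxnP exP ubP) => _ /asboolP[f hf <-] fmax.
(* Every f + n g is again a morphism, so the maximality of [f] bounds the total rank along the whole
   pencil. *)
have hmax g : is_hom B A g -> forall x k l (u : 'M_(k, a x)) (v : 'M_(b x, l)),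
    u *m f x = 0 -> f x *m v = 0 -> u *m g x *m v = 0.
  move=> hg; apply: (max_rank_pencil F0) => n; apply: fmax; apply/asboolP.
  exists (fun x => f x + n%:R *: g x) => // e.
  by rewrite mulmxDr mulmxDl -scalemxAr -scalemxAl hf hg.
pose j x : nat := \rank (f x).
have [I [i [p [hi hp fE [r ri] [s ps]]]]] := image_factor hf (fun x => erefl (j x)).
have [K [iK [rK sesB]]] := quot_ses hp ps.
have [C [sC [pC sesA]]] := sub_ses hi ri.
have pCi x : pC x *m i x = 0 by case: sesA => _ _ /(_ x)[].
have piK x : p x *m iK x = 0 by case: sesB => _ _ /(_ x)[].
have homKC : hom_zero K C.
  apply: (kernel_hom_zero genBA sesB sesA) => g hg x; apply: hmax => //.
    by rewrite fE mulmxA pCi mul0mx.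
  by rewrite fE -mulmxA piK mulmx0.
have nextKC : ~ ext_zero K C.
  by move=> h; apply: next; exact: (kernel_ext_zero genBA sesB sesA).
have extKI := generic_ses_ext_zero (generic_pairl genBA) sesB.
have extIC := generic_ses_ext_zero (generic_pairr genBA) sesA.
(* The invariant survives the removal of an image J of I: Ext(K, J) = 0 gives <K, J> >= 0, so <K,
   D/J> stays negative. *)
pose R d (D : mrep F d) :=
  ext_zero I D /\ euler_form (dimZ (dim_sub b j)) (dimZ d) < 0.
have [||d [D [qCD [_ kd] homID]]] := @kill_images _ _ _ _ I C R.
- by split=> //; exact: hom_zero_ext_nonzero homKC nextKC.
- move=> d D m J d' D' i1 r1 s1 p1 [extID kd] qIJ sesD.
  split; first exact: ext_zero_quotr extID (ses_quot sesD).
  have := ext_zero_euler (ext_zero_quotr extKI qIJ).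
  by move: kd; rewrite (euler_addr _ (ses_dim sesD)); lia.
(* Now <I, D> <= 0 since Hom(I, D) = 0, so <B, D> = <K, D> + <I, D> < 0 for a quotient [D] of
   [A]. *)
have := semi _ _ (quot_trans (ses_quot sesA) qCD).
have := hom_zero_euler homID.
by rewrite (euler_addl _ (ses_dim sesB)); lia.
Qed.

End GenericVanishing.

(** * Derivations and specialization of rational functions *)

Section FractionDerivations.
Variable R : idomainType.
Local Notation F := {fraction R}.
Local Notation tofrac := (@FracField.tofrac R).
Local Open Scope quotient_scope.

Lemma fractionE (x : F) : exists n d, d != 0 /\ x = tofrac n / tofrac d.
Proof.
exists (repr x).1, (repr x).2; have d0 := denom_ratioP (repr x); split=> //.
apply: (canRL (mulfK _)); first by rewrite tofrac_eq0.
rewrite -{1}[x]reprK; unlock FracField.tofrac.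
rewrite -[LHS]FracField.pi_mul; apply/eqmodP; rewrite /= FracField.equivfE /FracField.mulf /=.
by rewrite !numden_Ratio ?oner_neq0 ?mulf_neq0 ?oner_neq0 // !mulr1 mulrC.
Qed.

Variable delta : R -> R.
Hypothesis deltaD : forall x y, delta (x + y) = delta x + delta y.
Hypothesis deltaM : forall x y, delta (x * y) = delta x * y + x * delta y.

Definition frac_der (x : F) : F :=
  let n := projT1 (cid (fractionE x)) in
  let d := projT1 (cid (projT2 (cid (fractionE x)))) in
  tofrac (delta n * d - n * delta d) / tofrac (d ^+ 2).

(** The quotient rule does not depend on the chosen fraction: the relation n q = p d can itself be
    differentiated. *)
Lemma frac_derE n d : d != 0 ->
  frac_der (tofrac n / tofrac d) = tofrac (delta n * d - n * delta d) / tofrac (d ^+ 2).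
Proof.
move=> d0; rewrite /frac_der; case: cid => p /= ex; case: cid => q /= [q0 e].
have E : n * q = p * d.
  apply/eqP; rewrite -tofrac_eq !tofracM; apply/eqP.
  have tq : tofrac q != 0 by rewrite tofrac_eq0.
  have td : tofrac d != 0 by rewrite tofrac_eq0.
  by move/(congr1 (fun z => z * tofrac d * tofrac q)): e; rewrite divfK // mulrAC divfK.
have E2 := congr1 delta E; rewrite !deltaM in E2.
apply/eqP; rewrite eqr_div ?tofrac_eq0 ?expf_neq0 // -!tofracM tofrac_eq -subr_eq0.
(* The difference of the cross products is a combination of the relation [E] and its derivative
   [E2]. *)
have -> : (delta p * q - p * delta q) * d ^+ 2 - (delta n * d - n * delta d) * q ^+ 2
  = d * q * (delta p * d + p * delta d - (delta n * q + n * delta q))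
    + (n * q - p * d) * (delta d * q + delta q * d) by ring.
by rewrite E E2 !subrr mulr0 mul0r addr0.
Qed.

Lemma frac_der_derivation : derivation frac_der.
Proof.
split=> x y; have [n [d [d0 ->]]] := fractionE x; have [p [q [q0 ->]]] := fractionE y.
  have td : tofrac d != 0 by rewrite tofrac_eq0.
  have tq : tofrac q != 0 by rewrite tofrac_eq0.
  rewrite addf_div // -!tofracM -tofracD !frac_derE ?mulf_neq0 //.
  rewrite addf_div ?tofrac_eq0 ?expf_neq0 // -!tofracM -tofracD !deltaD !deltaM.
  apply/eqP; rewrite eqr_div ?tofrac_eq0 ?mulf_neq0 ?expf_neq0 ?mulf_neq0 // -!tofracM tofrac_eq.
  by apply/eqP; ring.
rewrite mulf_div -!tofracM !frac_derE ?mulf_neq0 // !deltaM.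
rewrite !mulf_div -!tofracM addf_div ?tofrac_eq0 ?mulf_neq0 ?expf_neq0 // -!tofracM -tofracD.
apply/eqP; rewrite eqr_div ?tofrac_eq0 ?mulf_neq0 ?expf_neq0 ?mulf_neq0 // -!tofracM tofrac_eq.
by apply/eqP; ring.
Qed.

Lemma frac_der_tofrac n : frac_der (tofrac n) = tofrac (delta n).
Proof.
have d1 : delta 1 = 0.
  have := deltaM 1 1; rewrite !mulr1 mul1r => /eqP.
  by rewrite -subr_eq subrr eq_sym => /eqP.
rewrite -[tofrac n]divr1 -tofrac1 frac_derE ?oner_neq0 // d1.
by rewrite mulr1 mulr0 subr0 expr1n tofrac1 divr1.
Qed.

Lemma common_denominator (T : finType) (x : T -> F) :
  exists2 q, q != 0 & exists y : T -> R, forall t, tofrac q * x t = tofrac (y t).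
Proof.
have [n /fin_all_exists[d h]] := fin_all_exists (fun t => fractionE (x t)).
exists (\prod_t d t); first by apply/prodf_neq0 => t _; case: (h t).
exists (fun t => n t * \prod_(u | u != t) d u) => t; have [d0 ->] := h t.
by rewrite (bigD1 t) //= !tofracM; field; rewrite tofrac_eq0.
Qed.

End FractionDerivations.

Section Specialization.
Variable K : fieldType.
Hypothesis K0 : [pchar K] =i pred0.

(** Induction on the number of variables, viewing [p] through [muni] as a polynomial in the last
    one: a coefficient nonzero at [v] leaves a nonzero univariate polynomial, which has a natural
    number as non-root. *)
Lemma mpoly_nonzero_point n (p : {mpoly K[n]}) : p != 0 -> exists v, p.@[v] != 0.
Proof.
elim: n p => [|n IHn] p p0.
  exists (fun _ => 0); apply: contraNneq p0 => pv.
  have m0 (m : 'X_{1..0}) : m = 0%MM by apply/mnmP; case.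
  apply/eqP/mpolyP=> m; rewrite mcoeff0 -[RHS]pv (m0 m).
  rewrite [p in RHS]mpolyE raddf_sum /= [p in LHS]mpolyE raddf_sum /=.
  apply: eq_bigr => m' _.
  by rewrite mcoeffZ mcoeffX mevalZ mevalX big_ord0 (m0 m') eqxx.
pose restr (m : 'X_{1..n.+1}) := [multinom m (widen_ord (leqnSn n) i) | i < n].
have [m pm] : exists m, p@_m != 0.
  apply: contrapT => h; move: p0 => /eqP; apply; apply/mpolyP=> m; rewrite mcoeff0.
  by apply: contrapT => /eqP pm; apply: h; exists m.
pose q := (muni p)`_(m ord_max).
have q0 : q != 0.
  apply: contraNneq pm => q0.
  have -> : p@_m = q@_(restr m); last by rewrite q0 mcoeff0.
  rewrite /q muniE coef_sum raddf_sum /= {1}[p]mpolyE raddf_sum /=; apply: eq_bigr => m' _.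
  rewrite mcoeffZ mcoeffX coefZ coefXn.
  have [e|ne] := eqVneq (m ord_max) (m' ord_max); last first.
    rewrite mulr0 mcoeff0; case: eqP => [e|_]; last by rewrite mulr0.
    by rewrite e eqxx in ne.
  rewrite mulr1 mcoeffZ mcoeffX; congr (_ * (nat_of_bool _)%:R).
  apply/eqP/eqP => [->//|/mnmP h]; apply/mnmP => i.
  have [lt_in|] := ltnP i n.
    have := h (Ordinal lt_in); rewrite !mnmE.
    by have -> : widen_ord (leqnSn n) (Ordinal lt_in) = i by exact: val_inj.
  move=> le_ni; have -> : i = ord_max; last by rewrite e.
  by apply/val_inj/eqP; rewrite eqn_leq le_ni -ltnS ltn_ord.
have [v qv] := IHn q q0.
pose S := map_poly (meval v) (muni p).
have S0 : S != 0.
  apply: contraNneq qv => S0.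
  by rewrite -[q.@[v]]/(meval v q) /q -coef_map -/S S0 coef0.
have [t St] := poly_nat_nonroot K0 S0.
(* [insub] fails exactly at the last index, where the default [t%:R] is taken. *)
exists (fun i => oapp v t%:R (insub (val i))).
apply: contra St => /eqP pv; apply/eqP; rewrite -[RHS]pv /S muniE.
rewrite rmorph_sum horner_sum mevalE; apply: eq_bigr => m' _.
rewrite big_ord_recr /= map_polyZ map_polyXn hornerZ hornerXn /=.
rewrite mevalZ mevalX -mulrA [insub n]insubF ?ltnn //=; congr (_ * (_ * _)).
by apply: eq_bigr => i _; rewrite mnmE valK.
Qed.

Variable N : nat.
Local Notation P := {mpoly K[N]}.
Local Notation F := {fraction P}.

Lemma pchar_frac : [pchar F] =i pred0.
Proof.
apply/pcharf0P => n; rewrite -tofrac1 -tofracMn tofrac_eq0.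
by rewrite -mpolyC_nat mpolyC_eq0 (pcharf0P K).1.
Qed.

Lemma frac_mpoly_derivation (w : 'I_N -> F) :
  exists2 D : F -> F, derivation D & forall i, D (FracField.tofrac 'X_i) = w i.
Proof.
pose D i := frac_der (@mderiv N K i).
have dD i : derivation (D i) := frac_der_derivation (mderivD i) (mderivM i).
exists (fun x => \sum_i w i * D i x).
  split=> x y.
    by rewrite -big_split; apply: eq_bigr => i _; rewrite (dD i).1 mulrDr.
  rewrite mulr_suml mulr_sumr -big_split; apply: eq_bigr => i _.
  by rewrite (dD i).2 /=; ring.
move=> i; rewrite (bigD1 i) //= big1 ?addr0 => [|j ji].
  rewrite /D (frac_der_tofrac (mderivM _)).
  have -> : ('X_i : P)^`M(i) = 1.
    rewrite mderivX mnmE eqxx scale1r -mpolyX0; congr 'X_[_].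
    by apply/mnmP => j; rewrite mnmBE subnn mnm0E.
  by rewrite tofrac1 mulr1.
rewrite /D (frac_der_tofrac (mderivM _)).
by rewrite mderivX mnmE eq_sym (negPf ji) scale0r tofrac0 mulr0.
Qed.

End Specialization.

(** * The universal pair of representations and its specializations *)

Section UniversalPair.
Variables (Q : quiver) (K : fieldType).
Hypothesis K0 : [pchar K] =i pred0.
Implicit Types (a b c d u w : dimension Q).

Definition map_rep (S S' : Type) (h : S -> S') a (A : mrep S a) : mrep S' a :=
  fun e => map_mx h (A e).

Notation nvar b a := #|((Defs.coord b + Defs.coord a)%type : finType)|.
Notation tofrac := (@FracField.tofrac _).

(** The two universal representations share one polynomial ring but use disjoint sets of
    indeterminates, so that derivations move them independently. *)
Definition univl b a : mrep {mpoly K[nvar b a]} b :=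
  fun e => \matrix_(i, j) 'X_(enum_rank (inl (Tagged _ (i, j) : Defs.coord b))).

Definition univr b a : mrep {mpoly K[nvar b a]} a :=
  fun e => \matrix_(i, j) 'X_(enum_rank (inr (Tagged _ (i, j) : Defs.coord a))).

Lemma generic_univ b a :
  generic_pair (map_rep tofrac (univl b a)) (map_rep tofrac (univr b a)).
Proof.
move=> m n.
pose w (k : 'I_(nvar b a)) := match enum_val k with
  | inl c => m (tag c) (tagged c).1 (tagged c).2
  | inr c => n (tag c) (tagged c).1 (tagged c).2 end.
have [D dD DX] := frac_mpoly_derivation w.
by exists D => //; split=> e; apply/matrixP=> i j; rewrite !mxE DX /w enum_rankK.
Qed.

Lemma univr_eval b a (A : mrep K a) :
  exists v, forall e, map_rep (meval v) (univr b a) e = A e.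
Proof.
exists (fun k => match enum_val k with
  | inl c => 0
  | inr c => A (tag c) (tagged c).1 (tagged c).2 end).
by move=> e; apply/matrixP=> i j; rewrite !mxE mevalXU enum_rankK.
Qed.

Variable N : nat.
Notation P := {mpoly K[N]}.
Notation F := {fraction P}.

Lemma tofrac_mx_inj m n (A B : 'M[P]_(m, n)) :
  map_mx tofrac A = map_mx tofrac B -> A = B.
Proof.
by move=> /matrixP h; apply/matrixP=> i j; have := h i j; rewrite !mxE => /eqP; rewrite tofrac_eq => /eqP.
Qed.

Lemma denominator_fam (T : finType) (p q : T -> nat) (f : fam p q F) :
  exists2 d : P, d != 0 & exists g : fam p q P,
    forall t, tofrac d *: f t = map_mx tofrac (g t).
Proof.
have [d d0 [y h]] := common_denominator
  (fun c : idx p q => f (tag c) (tagged c).1 (tagged c).2).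
exists d => //; exists (fun t => \matrix_(i, j) y (Tagged _ (i, j))) => t.
by apply/matrixP=> i j; rewrite !mxE -h.
Qed.

(** Hom = 0 is witnessed by a right inverse of the coboundary matrix. Clearing denominators turns it
    into a polynomial identity with right side [q%:M], to be evaluated where [q] is nonzero. *)
Lemma hom_zero_specialize u w (U : mrep F u) (W : mrep F w) :
  hom_zero U W -> exists U0 : mrep K u, exists W0 : mrep K w, hom_zero U0 W0.
Proof.
move=> hUW.
have [d d0 [U1 hU]] := denominator_fam U.
have [d' d'0 [W1 hW]] := denominator_fam W.
(* Crossing the denominators multiplies [U] and [W] by the same scalar d d', which leaves the
   homomorphisms unchanged. *)
pose U2 : mrep P u := fun e => d' *: U1 e.
pose W2 : mrep P w := fun e => d *: W1 e.
have hU2 e : map_rep tofrac U2 e = tofrac (d * d') *: U e.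
  by rewrite /map_rep map_mxZ -hU scalerA -tofracM mulrC.
have hW2 e : map_rep tofrac W2 e = tofrac (d * d') *: W e.
  by rewrite /map_rep map_mxZ -hW scalerA -tofracM.
have : hom_zero (map_rep tofrac U2) (map_rep tofrac W2).
  move=> f hf; apply: hUW => e; have := hf e.
  rewrite hU2 hW2 -scalemxAl -scalemxAr; apply: scalerI.
  by rewrite tofrac_eq0 mulf_neq0.
move/hom_zeroP; rewrite -(map_cobd_mx tofrac U2 W2) => /row_freeP[E DE].
have [q q0 [E1 hE]] := denominator_fam (T := unit) (p := fun=> _) (q := fun=> _) (fun=> E).
have DE1 : cobd_mx U2 W2 *m E1 tt = q%:M.
  apply: tofrac_mx_inj; rewrite map_mxM -hE -scalemxAr DE map_scalar_mx.
  by rewrite scale_scalar_mx mulr1.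
have [v qv] := mpoly_nonzero_point K0 q0.
exists (map_rep (meval v) U2), (map_rep (meval v) W2).
apply/hom_zeroP; rewrite -(map_cobd_mx (meval v) U2 W2); apply/row_freeP.
exists (q.@[v]^-1 *: map_mx (meval v) (E1 tt)).
by rewrite -scalemxAr -map_mxM DE1 map_scalar_mx scale_scalar_mx mulVf.
Qed.

(** Cleared of denominators, the quotient structure is encoded by the polynomial identities [ps1]
    and [pAs1], which still define a quotient wherever d d' is nonzero; the point is chosen off the
    zeros of [g] as well. *)
Lemma quot_specialize a c (A : mrep P a) (C : mrep F c) (g : P) :
  is_quot (map_rep tofrac A) C -> g != 0 ->
  exists2 v, g.@[v] != 0 & exists C0 : mrep K c, is_quot (map_rep (meval v) A) C0.
Proof.
move=> [p [s [hp ps]]] g0.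
have [d d0 [p1 hp1]] := denominator_fam p.
have [d' d'0 [s1 hs1]] := denominator_fam s.
have ps1 x : p1 x *m s1 x = (d * d')%:M.
  apply: tofrac_mx_inj; rewrite map_mxM -hp1 -hs1 -scalemxAl -scalemxAr ps scalerA.
  by rewrite map_scalar_mx scale_scalar_mx mulr1 /= tofracM.
have pAs1 e : p1 (qhead e) *m A e *m s1 (qtail e) *m p1 (qtail e)
    = (d * d') *: (p1 (qhead e) *m A e).
  apply: tofrac_mx_inj; rewrite map_mxZ !map_mxM -!hp1 -hs1.
  rewrite -!scalemxAl -!scalemxAr -!scalemxAl -hp -[C e *m p _ *m s _]mulmxA ps mulmx1.
  by rewrite !scalerA /= !tofracM; congr (_ *: _); ring.
have [|v] := mpoly_nonzero_point K0 (p := g * (d * d')).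
  by rewrite !mulf_neq0.
rewrite mevalM mulf_eq0 negb_or => /andP[gv dv]; exists v => //.
pose k := (d * d').@[v]; pose ev m n := @map_mx _ _ (meval v) m n.
exists (fun e => k^-1 *: (ev _ _ (p1 (qhead e)) *m ev _ _ (A e) *m ev _ _ (s1 (qtail e)))).
exists (fun x => ev _ _ (p1 x)), (fun x => k^-1 *: ev _ _ (s1 x)); split=> [e|x].
  rewrite -scalemxAl /ev -!map_mxM pAs1 map_mxZ scalerA.
  by rewrite [_ * meval v _]mulVf // scale1r map_mxM.
by rewrite -scalemxAr /ev -map_mxM ps1 map_scalar_mx scale_scalar_mx mulVf.
Qed.

End UniversalPair.

(** * Semi-invariants and subrepresentations *)

Section PolynomialCurves.

Lemma rmorph_mmap n (K S S' : comNzRingType) (f : {rmorphism K -> S})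
    (f' : {rmorphism K -> S'}) (phi : {rmorphism S -> S'}) h h' (p : {mpoly K[n]}) :
  (forall c, phi (f c) = f' c) -> (forall i, phi (h i) = h' i) ->
  phi (mmap f h p) = mmap f' h' p.
Proof.
move=> ff hh; rewrite /mmap rmorph_sum; apply: eq_bigr => m _.
rewrite rmorphM ff /mmap1 rmorph_prod; congr (_ * _).
by apply: eq_bigr => i _; rewrite rmorphXn hh.
Qed.

Variable K : fieldType.
Hypothesis K0 : [pchar K] =i pred0.

Lemma mmap_polyC_horner n (h : 'I_n -> {poly K}) (p : {mpoly K[n]}) t :
  (mmap (@polyC K) h p).[t] = p.@[fun i => (h i).[t]].
Proof.
rewrite -/(horner_eval t _).
by apply: rmorph_mmap => // c; rewrite /= horner_evalE hornerC.
Qed.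

(* The lowest-order term of [p] at [q] is nonzero in the direction [x], and
   it only depends on the first-order part of the curve [q + 'X * z]. *)
Lemma lowest_order_direction n (p : {mpoly K[n]}) (q : 'I_n -> K) : p != 0 ->
  exists x : 'I_n -> K, forall z : 'I_n -> {poly K}, (forall i, (z i).[0] = x i) ->
    mmap (@polyC K) (fun i => (q i)%:P + 'X * z i) p != 0.
Proof.
move=> p0.
(* [G] is p(q + X x): a polynomial in X whose coefficients are polynomials in an indeterminate
   direction x. *)
pose G : {poly {mpoly K[n]}} := mmap (@polyC {mpoly K[n]} \o @mpolyC n K)
  (fun i => ((q i)%:MP)%:P + 'X * ('X_i)%:P) p.
have G0 : G != 0.
  have [v] := mpoly_nonzero_point K0 p0; apply: contraNneq => Gz.
  pose Phi : {rmorphism {poly {mpoly K[n]}} -> K} := horner_eval (1 : K) \o map_poly (meval (fun i => v i - q i)).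
  have : Phi G = 0 by rewrite /Phi /= Gz !raddf0.
  rewrite /meval => <-; apply/eqP/esym; apply: rmorph_mmap => [c|i].
    by rewrite /Phi /= map_polyC /= mevalC horner_evalE hornerC.
  rewrite /Phi /= rmorphD rmorphM /= !map_polyC map_polyX /= mevalC mevalXU.
  by rewrite horner_evalE !hornerE /= [q i + _]addrC addrK.
(* With G = X^m H, the value H(0) is the lowest-order term, and the direction is a point where it is
   nonzero. *)
have [m [H]] := multiplicity_XsubC G 0.
rewrite G0 /= subr0 => H0 GH.
have [x hx] := mpoly_nonzero_point K0 H0.
exists x => z zx.
pose Phi : {rmorphism {poly {mpoly K[n]}} -> {poly K}} := horner_eval ('X : {poly K}) \o map_poly (mmap (@polyC K) z).
have <- : Phi G = mmap (@polyC K) (fun i => (q i)%:P + 'X * z i) p.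
  apply: rmorph_mmap => [c|i].
    by rewrite /Phi /= map_polyC /= mmapC horner_evalE hornerC.
  rewrite /Phi /= rmorphD rmorphM /= !map_polyC map_polyX /= mmapC mmapX mmap1U.
  by rewrite horner_evalE !hornerE.
rewrite GH /Phi /= rmorphM rmorphXn /= map_polyX horner_evalE hornerM hornerXn.
rewrite mulf_neq0 ?expf_neq0 ?polyX_eq0 //.
apply: contraNneq hx => Hz.
have : horner_eval 0 (map_poly (mmap (@polyC K) z) H).['X] = 0.
  by rewrite Hz raddf0.
rewrite -horner_map /= horner_evalE hornerX !horner_coef0 !coef_map /=.
move=> <-; apply/eqP/esym; apply: rmorph_mmap => [c|i] /=.
  by rewrite horner_evalE hornerC.
by rewrite horner_evalE zx.
Qed.

End PolynomialCurves.

Section SemiInvariants.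
Variables (R : realType) (Q : quiver).
Local Notation C := R[i].
Implicit Types (a b c : dimension Q).

Lemma pchar_complex : [pchar C] =i pred0.
Proof. exact: pchar_num. Qed.

Lemma eq_rep a (V V' : rep R a) : (forall e, V e = V' e) -> V = V'.
Proof. exact: functional_extensionality_dep. Qed.

Lemma curve_polynomial a (f : rep R a -> C) (H : mrep {poly C} a) :
  polynomial_function f ->
  exists P : {poly C}, forall t, P.[t] = f (map_rep (horner_eval t) H).
Proof.
move=> [p fp].
exists (mmap (@polyC C) (fun i => let c := enum_val i in H (tag c) (tagged c).1 (tagged c).2) p).
move=> t; rewrite mmap_polyC_horner fp; apply: meval_eq => i.
by rewrite /coord_val /map_rep mxE horner_evalE.
Qed.

Lemma chi_one_ps a c (s : weight Q) (i : fam0 C a c) (p : fam0 C c a) (t : C) :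
  (forall x, p x *m i x = 1%:M) -> t != 0 ->
  chi s (fun x => 1%:M + i x *m ((t - 1) *: p x)) = t ^ weight_eval s (dimZ c).
Proof.
move=> pi t0; rewrite /chi /weight_eval.
rewrite (big_morph (fun n => t ^ n) (fun m n => expfzDr m n t0) (expr0z t)).
apply: eq_bigr => x _; rewrite det_add1_mulC -scalemxAl pi scalemx1.
rewrite -[1%:M + _]raddfD /= addrC subrK det_scalar.
by rewrite /dimZ mulrC -exprz_exp.
Qed.

(** Let g act by t on a complement of the kernel of V -> W and trivially on the kernel. Then g^-1 V
    = V0 + t V1 is a polynomial curve along which f equals t^s(c) f(V) for t nonzero; a polynomial
    in t cannot have a negative exponent. *)
Lemma SI_quot_weight a c (s : weight Q) (f : rep R a -> C) (V : rep R a) (W : mrep C c) :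
  SI R a s f -> f V != 0 -> @is_quot Q C a c V W -> 0 <= weight_eval s (dimZ c).
Proof.
move=> [fpol fsi] fV [p [r [hp pr]]].
pose V0 : mrep C a := fun e => V e - (1%:M - r (qhead e) *m p (qhead e)) *m V e *m (r (qtail e) *m p (qtail e)).
pose V1 : mrep C a := fun e => (1%:M - r (qhead e) *m p (qhead e)) *m V e *m (r (qtail e) *m p (qtail e)).
have [P hP] := curve_polynomial (fun e => map_mx polyC (V0 e) + 'X *: map_mx polyC (V1 e)) fpol.
have PE t : t != 0 -> P.[t] = t ^ weight_eval s (dimZ c) * f V.
  move=> t0; have chit := chi_one_ps s pr t0.
  pose g : mxfamily R a := fun x => 1%:M + r x *m ((t - 1) *: p x).
  pose g' : mxfamily R a := fun x => 1%:M + r x *m ((t^-1 - 1) *: p x).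
  have gg' x : g x *m g' x = 1%:M.
    rewrite /g /g' mulmxDl mul1mx mulmxDr mulmx1 -!mulmxA.
    rewrite -scalemxAl [p x *m _]mulmxA pr mul1mx -!scalemxAr !scalerA -!scalerDl.
    rewrite -!addrA -scalerDl.
    set u := (X in X *: _); have -> : u = 0 by rewrite /u; field.
    by rewrite scale0r addr0.
  have gu : in_GL g by move=> x; exact: (proj1 (mulmx1_unit (gg' x))).
  rewrite hP -chit -[RHS](fsi g gu V).
  rewrite /fun_act; congr f; apply: eq_rep => e.
  rewrite /rep_act /GL_inv invmxK.
  have -> : invmx (g (qhead e)) = g' (qhead e).
    by rewrite -[LHS]mulmx1 -(gg' (qhead e)) mulmxA mulVmx ?gu // mul1mx.
  have VX : r (qhead e) *m p (qhead e) *m V e *m (r (qtail e) *m p (qtail e))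
     = r (qhead e) *m p (qhead e) *m V e.
    rewrite -[r _ *m p _ *m V e]mulmxA -hp -!mulmxA.
    by rewrite [p _ *m (r _ *m _)]mulmxA pr mul1mx.
  pose A := r (qhead e) *m p (qhead e) *m V e.
  pose B := V e *m (r (qtail e) *m p (qtail e)).
  have -> : g' (qhead e) *m V e *m g (qtail e) =
      V e + (t - 1) *: B + ((t^-1 - 1) *: A + (t - 1) *: ((t^-1 - 1) *: A)).
    rewrite /g' /g mulmxDl mul1mx -!scalemxAr -scalemxAl -/A.
    rewrite mulmxDr mulmx1 -scalemxAr mulmxDl -/B -scalemxAl VX -/A scalerDr.
    by rewrite addrACA.
  rewrite /map_rep /V0 /V1 mulmxBl mul1mx mulmxBl -/B VX -/A.
  clearbody A B; apply/matrixP=> j k; rewrite !mxE /= horner_evalE !hornerE /=.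
  by field.
rewrite leNgt; apply/negP; case sn: (weight_eval s (dimZ c)) => [n|n] // _.
(* For s(c) = -(n+1), [S] vanishes at every nonzero t, although its constant term is -f(V). *)
pose S := P * 'X^(n.+1) - (f V)%:P.
have S0 : S != 0.
  apply: contraNneq fV => /(congr1 (horner^~ 0)); rewrite horner0 !hornerE.
  by rewrite expr0n /= mulr0 sub0r => /eqP; rewrite oppr_eq0.
have [m] := poly_nat_nonroot pchar_complex (mulf_neq0 S0 (negbT (polyX_eq0 C))).
rewrite hornerM hornerX mulf_eq0 negb_or => /andP[Sm m0].
case/negP: Sm; rewrite !hornerE PE // sn NegzE -exprnN.
by rewrite mulrAC mulVf ?mul1r ?subrr // expf_neq0.
Qed.

Lemma SI_weight_zero a (s : weight Q) : Sigma R a s -> weight_eval s (dimZ a) = 0.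
Proof.
move=> [f [_ fsi] [V fV]].
(* The scalar 2 acts trivially on representations, so 2^s(a) = 1, and 2 is not a root of unity. *)
have two0 : (2 : C) != 0 by rewrite pnatr_eq0.
pose g : mxfamily R a := fun x => 1%:M + 1%:M *m ((2 - 1) *: 1%:M).
have gE x : g x = 2%:M.
  rewrite /g mul1mx scale_scalar_mx mulr1 -raddfD /=.
  by congr (_%:M); ring.
have gu x : g x \in unitmx by rewrite gE unitmxE det_scalar unitfE expf_neq0.
have := fsi g gu V; rewrite (@chi_one_ps a a s (fun x => 1%:M) (fun x => 1%:M)) //; last first.
  by move=> x; rewrite mulmx1.
have -> : fun_act g f V = f V.
  rewrite /fun_act; congr f; apply: eq_rep => e; rewrite /rep_act /GL_inv invmxK !gE.
  by rewrite invmx_scalar mul_mx_scalar mul_scalar_mx scalerA mulfV ?scale1r.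
move/eqP; rewrite -[X in X == _]mul1r eq_sym -subr_eq0 -mulrBl mulf_eq0 (negPf fV) orbF.
rewrite subr_eq0; case: (weight_eval _ _) => k; rewrite ?NegzE -?exprnN ?invr_eq1.
  by rewrite -exprnP pexprn_eq1 ?ler0n // pnatr_eq1 orbF => /eqP ->.
by rewrite pexprn_eq1 ?ler0n // pnatr_eq1 orbF.
Qed.

Lemma dim_splitting (K : nzRingType) (a b c : nat) : a = (b + c)%N ->
  exists i : 'M[K]_(a, b), exists r s p, @split_seq K a b c i r s p.
Proof.
move=> ->; exists (col_mx 1%:M 0), (row_mx 1%:M 0), (col_mx 0 1%:M), (row_mx 0 1%:M).
split; rewrite ?mul_row_col ?mulmx1 ?mulmx0 ?mul0mx ?addr0 ?add0r //.
rewrite !mul_col_row ?(mulmx1, mulmx0, mul0mx) add_block_mx !addr0 !add0r.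
by rewrite -scalar_mx_block.
Qed.

(** An infinitesimal base change replaces the first-order term Y of a curve through q by X. The full
    expansion is kept so that the result has the shape required by [lowest_order_direction]. *)
Lemma conj_unipotent_curve (K : comNzRingType) (m n : nat) (M : 'M[K]_m) (N : 'M_n)
    (q X Y : 'M_(m, n)) (t : K) : q *m N - M *m q = X - Y ->
  (1%:M - t *: M) *m (q + t *: Y) *m (1%:M + t *: N) =
  q + t *: (X + t *: (Y *m N - M *m Y - M *m q *m N) - (t ^+ 2) *: (M *m Y *m N)).
Proof.
move=> qN; rewrite -[X](subrK Y) -qN mulmxDr mulmx1.
have -> : (1%:M - t *: M) *m (q + t *: Y) =
    q + t *: Y - t *: (M *m q) - (t ^+ 2) *: (M *m Y).
  rewrite mulmxBl mul1mx -scalemxAl mulmxDr -scalemxAr scalerDr scalerA -expr2.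
  by rewrite opprD addrA.
have -> : (q + t *: Y - t *: (M *m q) - (t ^+ 2) *: (M *m Y)) *m (t *: N) =
    t *: (q *m N) + (t ^+ 2) *: (Y *m N) - (t ^+ 2) *: (M *m q *m N)
    - (t ^+ 3) *: (M *m Y *m N).
  rewrite -scalemxAr !mulmxBl mulmxDl -!scalemxAl !scalerBr scalerDr !scalerA.
  by rewrite -!exprS -expr2.
move: (M *m q *m N) (M *m Y *m N) (M *m q) (M *m Y) (q *m N) (Y *m N).
move=> M1 M2 M3 M4 M5 M6.
by apply/matrixP=> i j; rewrite !mxE; ring.
Qed.

(* Since Ext(B, W) = 0, every tangent vector at B + W is, up to an
   infinitesimal base change, a deformation that keeps W as a quotient. *)
Lemma SI_nonzero_quot a b c (B : mrep C b) (W : mrep C c) (s : weight Q) f :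
  (forall x, a x = b x + c x)%N -> ext_zero B W ->
  SI R a s f -> (exists V, f V != 0) ->
  exists2 V : rep R a, f V != 0 & exists W' : mrep C c, @is_quot Q C a c V W'.
Proof.
move=> abc extBW [fpol fsi] [V0 fV0].
have /fin_all_exists[i /fin_all_exists[r /fin_all_exists[u /fin_all_exists[p sp]]]] :=
  fun x => dim_splitting C (abc x).
have ri x : r x *m i x = 1%:M by case: (sp x).
have pu x : p x *m u x = 1%:M by case: (sp x).
have pi0 x : p x *m i x = 0 by case: (sp x).
have ru x : r x *m u x = 0 by case: (sp x).
have e1 x : i x *m r x + u x *m p x = 1%:M by case: (sp x).
have [pf fE] := fpol.
pose q : mrep C a := fun e =>
  i (qhead e) *m B e *m r (qtail e) + u (qhead e) *m W e *m p (qtail e).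
have pf0 : pf != 0 by apply: contraNneq fV0 => pf0; rewrite fE pf0 meval0.
have [x hx] := lowest_order_direction pchar_complex
  (fun k => coord_val (q : rep R a) (enum_val k)) pf0.
pose X : mrep C a := fun e => \matrix_(j, k) x (enum_rank (Tagged _ (j, k) : Defs.coord a)).
(* The component of X from B to W is what obstructs keeping W as a quotient; Ext(B, W) = 0 makes it
   a coboundary, and [Y] is X without it. *)
have [n hn] := extBW (fun e => p (qhead e) *m X e *m i (qtail e)).
pose N x := u x *m n x *m r x.
pose Y e := X e - u (qhead e) *m (p (qhead e) *m X e *m i (qtail e)) *m r (qtail e).
have NN y : N y *m N y = 0.
  by rewrite /N -!mulmxA [r y *m (u y *m _)]mulmxA ru mul0mx !mulmx0.
have qN e : q e *m N (qtail e) - N (qhead e) *m q e = X e - Y e.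
  have qu : q e *m u (qtail e) = u (qhead e) *m W e.
    by rewrite mulmxDl -!mulmxA ru pu !mulmx0 mulmx1 add0r.
  have rq : r (qhead e) *m q e = B e *m r (qtail e).
    by rewrite mulmxDr !mulmxA ri ru !mul0mx mul1mx addr0.
  rewrite /N !mulmxA qu -[_ *m r _ *m q e]mulmxA rq /Y -hn /cobd opprB [RHS]addrC subrK.
  by rewrite mulmxBr mulmxBl !mulmxA.
have pY e : p (qhead e) *m Y e *m i (qtail e) = 0.
  rewrite /Y mulmxBr mulmxBl !mulmxA pu mul1mx.
  by rewrite -[_ *m r _ *m i _]mulmxA ri mulmx1 subrr.
(* [q + 'X * Z] is the curve q + t Y transformed by 1 + t N, and Z(0) = X is the direction on which
   f does not vanish to lowest order. *)
pose Z : mrep {poly C} a := fun e => map_mx polyC (X e)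
  + 'X *: map_mx polyC (Y e *m N (qtail e) - N (qhead e) *m Y e - N (qhead e) *m q e *m N (qtail e))
  - ('X^2) *: map_mx polyC (N (qhead e) *m Y e *m N (qtail e)).
pose H : mrep {poly C} a := fun e => map_mx polyC (q e) + 'X *: Z e.
pose z (k : 'I_#|Defs.coord a|) := let d := enum_val k in Z (tag d) (tagged d).1 (tagged d).2.
have z0 k : (z k).[0] = x k.
  rewrite /z /Z !mxE !hornerE /= expr0n /= !mul0r !subr0 ?addr0.
  congr x; rewrite -[RHS]enum_valK; congr enum_rank.
  by case: (enum_val k) => ? [].
have [t] := poly_nat_nonroot pchar_complex (hx z z0).
rewrite mmap_polyC_horner.
set v := meval _ _.
pose Vt : rep R a := fun e => q e + t%:R *: Y e.
pose g : mxfamily R a := fun y => 1%:M + t%:R *: N y.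
pose g' : mxfamily R a := fun y => 1%:M - t%:R *: N y.
have g'g y : g' y *m g y = 1%:M.
  rewrite /g' /g mulmxBl mul1mx mulmxDr mulmx1 -scalemxAr -scalemxAl NN !scaler0 addr0.
  by rewrite addrK.
have -> : v = fun_act g f Vt.
  rewrite /fun_act fE; apply: meval_eq => k; rewrite /coord_val.
  rewrite /rep_act /GL_inv invmxK /z.
  case: (enum_val k) => e [j l] /=.
  have -> : invmx (g (qhead e)) = g' (qhead e).
    have [_ gu] := mulmx1_unit (g'g (qhead e)).
    by rewrite -[LHS]mul1mx -(g'g (qhead e)) -mulmxA mulmxV // mulmx1.
  have -> : g' (qhead e) *m Vt e *m g (qtail e) = q e + t%:R *: (X e
      + t%:R *: (Y e *m N (qtail e) - N (qhead e) *m Y e - N (qhead e) *m q e *m N (qtail e))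
      - (t%:R ^+ 2) *: (N (qhead e) *m Y e *m N (qtail e))).
    exact: conj_unipotent_curve.
  by rewrite !mxE !hornerE.
have gu : in_GL g by move=> y; exact: (proj2 (mulmx1_unit (g'g y))).
rewrite (fsi g gu Vt).
rewrite mulf_eq0 negb_or => /andP[_ fVt]; exists Vt => //.
exists (fun e => p (qhead e) *m Vt e *m u (qtail e)).
exists p, u; split=> // e.
have pVi : p (qhead e) *m Vt e *m i (qtail e) = 0.
  by rewrite /Vt mulmxDr mulmxDl -scalemxAr -scalemxAl pY scaler0 addr0
    mulmxDr mulmxDl !mulmxA -!mulmxA ri pi0 !mulmxA pi0 !mul0mx !mulmx0 addr0.
rewrite -mulmxA -[RHS]mulmx1 -e1 mulmxDr !mulmxA pVi mul0mx add0r //.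
Qed.

End SemiInvariants.

(** * Determinantal semi-invariants *)

Section BlockAction.
Variables (K : comNzRingType) (T : finType) (p q : T -> nat).
Variable g : forall t, 'M[K]_(p t).
Local Notation col_idx := {t : T & 'I_(q t)}.

Let colsel (s : col_idx) : 'M[K]_(#|idx p q|, p (tag s)) :=
  \matrix_(c, i) (c == idx_rank i (tagged s))%:R.

(* [fam_vec f] goes to [fam_vec (g f)]; the summand of index (t, j) acts on
   column j of [f t]. *)
Definition left_action_mx : 'M[K]_#|idx p q| :=
  1%:M + \sum_(s <- enum {: col_idx})
    colsel s *m ((g (tag s))^T - 1%:M) *m (colsel s)^T.

Let idx_rank_inj t (i i' : 'I_(p t)) (j j' : 'I_(q t)) :
  idx_rank i j = idx_rank i' j' -> i = i' /\ j = j'.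
Proof.
by move/enum_rank_inj/eqP; rewrite -tag_eqE /tag_eq eqxx /= tagged_asE => /eqP[].
Qed.

Let idx_rank_tag t t' (i : 'I_(p t)) (i' : 'I_(p t')) (j : 'I_(q t)) (j' : 'I_(q t')) :
  idx_rank i j = idx_rank i' j' -> Tagged (fun t => 'I_(q t)) j = Tagged (fun t => 'I_(q t)) j'.
Proof.
move/enum_rank_inj => e.
exact: (congr1 (fun c : idx p q => Tagged (fun t => 'I_(q t)) (tagged c).2) e).
Qed.

(** Each column of each matrix in the family is its own block, so [g t] contributes once for each of
    the [q t] columns. *)
Lemma det_left_action : \det left_action_mx = \prod_t \det (g t) ^+ q t.
Proof.
rewrite (det_add1_blocks (n := fun s : col_idx => p (tag s)) (U := fun s => (colsel s)^T)
  (V := colsel) (fun s => (g (tag s))^T)).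
- rewrite big_enum /= -(sig_big_dep (fun=> true) (fun _ _ => true) (fun t _ => \det (g t)^T)) /=.
  by apply: eq_bigr => t _; rewrite prodr_const card_ord det_tr.
- exact: enum_uniq.
- move=> [t j]; apply/matrixP=> i i'; rewrite !mxE (bigD1 (idx_rank i j)) //= !mxE eqxx mul1r.
  rewrite big1 ?addr0 => [|c ne]; last by rewrite !mxE (negPf ne) mul0r.
  congr (nat_of_bool _)%:R; apply/eqP/eqP => [/idx_rank_inj[]|->] //.
- move=> s s' ne; apply/matrixP=> i i'; rewrite !mxE big1 // => c _; rewrite !mxE.
  case: eqP => [->|_]; last by rewrite mul0r.
  case: eqP => [h|_]; last by rewrite mulr0.
  case/eqP: ne; case: s s' i i' h => [t j] [t' j'] /= i i' /idx_rank_tag //.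
Qed.

Lemma left_actionE (f : fam p q K) :
  fam_vec f *m left_action_mx = fam_vec (fun t => g t *m f t).
Proof.
rewrite -[LHS]vec_famK; apply: eq_fam_vec => t; apply/matrixP=> i j; rewrite [LHS]mxE.
rewrite -[LHS]/((fam_vec f *m left_action_mx) 0 (idx_rank i j)).
rewrite mulmxDr mulmx1 mulmx_sumr mxE summxE big_enum /=.
rewrite (bigD1 (Tagged (fun t => 'I_(q t)) j)) //= big1 ?addr0 => [|s ne]; last first.
  rewrite !mulmxA mxE big1 // => k _; rewrite [X in _ * X]mxE [X in _ * X]mxE.
  case: eqP => [h|_]; last by rewrite mulr0.
  case/eqP: ne; case: s k h => [t' j'] /= k /idx_rank_tag //.
have fE k : (fam_vec f *m colsel (Tagged (fun t => 'I_(q t)) j)) 0 k = f t k j.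
  rewrite mxE (bigD1 (idx_rank k j)) //= big1 ?addr0 => [|c ne]; last first.
    by rewrite [X in _ * X]mxE (negPf ne) mulr0.
  by rewrite [X in _ * X]mxE eqxx mulr1 mxE /idx_rank enum_rankK.
rewrite !mulmxA [X in _ + X]mxE (bigD1 i) //= big1 ?addr0 => [|k ne]; last first.
  rewrite [X in _ * X]mxE [X in _ * X]mxE; case: eqP => [/idx_rank_inj[ik _]|_]; last by rewrite mulr0.
  by rewrite ik eqxx in ne.
rewrite [X in _ + _ * X]mxE [X in _ + _ * X]mxE eqxx mulr1.
rewrite mulmxBr mulmx1 [in X in _ + X]mxE [X in _ + (_ + X)]mxE fE.
rewrite mxE /idx_rank enum_rankK /= addrC subrK [LHS]mxE [RHS]mxE.
by apply: eq_bigr => k _; rewrite fE [X in _ * X]mxE mulrC.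
Qed.

End BlockAction.

Section CastSquare.
Variables (K : fieldType) (n m : nat) (e : m = n).

Lemma row_free_castmx (M : 'M[K]_(n, m)) :
  row_free M -> castmx (erefl n, e) M \in unitmx.
Proof. by move: M; case: n / e => M h; rewrite castmx_id -row_free_unit. Qed.

Lemma det_castmx_mul (M M' : 'M[K]_(n, m)) (L : 'M_n) (L' : 'M_m) :
  M' *m L' = L *m M ->
  \det (castmx (erefl n, e) M') * \det L' = \det L * \det (castmx (erefl n, e) M).
Proof. by move: M M' L L'; case: n / e => M M' L L' h; rewrite !castmx_id -!det_mulmx h. Qed.

End CastSquare.

Section DeterminantalSemiInvariants.
Variables (R : realType) (Q : quiver).
Local Notation C := R[i].
Variables (a b : dimension Q) (B : mrep C b).
Hypothesis euler0 : euler_form (dimZ b) (dimZ a) = 0.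

Let dims : #|idx (T := arrow Q) (fun e => a (qhead e)) (fun e => b (qtail e))|
  = #|idx (T := vertex Q) a b|.
Proof. by move/eqP: euler0; rewrite card_euler subr_eq0 => /eqP[]. Qed.

(** Schofield's determinantal semi-invariant. The ring is arbitrary so that the determinant can be
    taken on a universal representation and then specialized. *)
Definition cobd_det (K : comNzRingType) (B' : mrep K b) (A : mrep K a) : K :=
  \det (castmx (erefl _, dims) (cobd_mx B' A)).

Lemma cobd_det_map (K K' : comNzRingType) (h : {rmorphism K -> K'}) (B' : mrep K b) (A : mrep K a) :
  h (cobd_det B' A) = cobd_det (map_rep h B') (map_rep h A).
Proof. by rewrite /cobd_det -det_map_mx map_castmx map_cobd_mx. Qed.

Lemma cobd_det_neq0 (A : mrep C a) : hom_zero B A -> cobd_det B A != 0.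
Proof.
by move=> /hom_zeroP h; rewrite /cobd_det -unitfE -unitmxE; exact: row_free_castmx.
Qed.

Let polynomial_cobd_det : polynomial_function (fun A : rep R a => cobd_det B A).
Proof.
pose U : mrep {mpoly C[#|Defs.coord a|]} a :=
  fun e => \matrix_(i, j) 'X_(enum_rank (Tagged _ (i, j) : Defs.coord a)).
exists (cobd_det (map_rep (@mpolyC _ _) B) U) => A.
pose v (i : 'I_#|Defs.coord a|) := coord_val A (enum_val i).
have BE : map_rep (meval v) (map_rep (@mpolyC _ _) B) = B.
  apply: functional_extensionality_dep => e.
  by apply/matrixP=> i j; rewrite !mxE; exact: mevalC.
have UE : map_rep (meval v) U = A.
  apply: functional_extensionality_dep => e.
  apply/matrixP=> i j; rewrite !mxE; apply: etrans (mevalXU _ _) _.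
  by rewrite /v enum_rankK.
by rewrite -{1}BE -{1}UE -(cobd_det_map (meval v)).
Qed.

(** The coboundary is equivariant: left multiplication by g intertwines the coboundary matrices of
    g^-1 A and A. The claim compares determinants. *)
Let cobd_det_act (g : mxfamily R a) (A : rep R a) : in_GL g ->
  cobd_det B (rep_act (GL_inv g) A) * \prod_e \det (g (qhead e)) ^+ b (qtail e)
    = \prod_x \det (g x) ^+ b x * cobd_det B A.
Proof.
move=> gu.
pose L0 := left_action_mx b g.
pose L1 := left_action_mx (p := fun e => a (qhead e)) (fun e => b (qtail e)) (fun e => g (qhead e)).
have E : cobd_mx B (rep_act (GL_inv g) A) *m L1 = L0 *m cobd_mx B A.
  apply/row_matrixP=> c; rewrite !row_mul !rowE; set v := delta_mx _ _.
  rewrite cobd_mxE left_actionE -[v in RHS]vec_famK left_actionE cobd_mxE.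
  apply: eq_fam_vec => d; rewrite /cobd !fam_vecK /rep_act /GL_inv invmxK.
  by rewrite mulmxBr !mulmxA (mulmxV (gu _)) mul1mx.
rewrite -(det_left_action b g) -/L0.
rewrite -(det_left_action (p := fun e => a (qhead e)) (fun e => b (qtail e)) (fun e => g (qhead e))) -/L1.
exact: det_castmx_mul.
Qed.

Lemma Sigma_cobd_det (A : mrep C a) : hom_zero B A -> Sigma R a (euler_weight (dimZ b)).
Proof.
move=> hBA; exists (fun A : rep R a => cobd_det B A); last first.
  by exists A; exact: cobd_det_neq0.
split=> // g gu V; rewrite /fun_act.
have gn0 x : \det (g x) != 0 by rewrite -unitfE; exact: gu.
have p0 : \prod_e \det (g (qhead e)) ^+ b (qtail e) != 0.
  by apply/prodf_neq0 => e _; rewrite expf_neq0.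
apply: (mulIf p0); rewrite (cobd_det_act _ gu) mulrAC; congr (_ * _).
(* Grouping arrows by head, the exponent of det(g x) is b(x) minus the sum of b(ta) over arrows a
   into x, which is <b, .> at x. *)
rewrite /chi [X in _ * X](partition_big (@qhead Q) xpredT) //= -big_split /=.
apply: eq_bigr => x _.
have -> : \prod_(e | qhead e == x) \det (g (qhead e)) ^+ b (qtail e) =
    \det (g x) ^ (\sum_(e | qhead e == x) (b (qtail e))%:Z).
  rewrite (big_morph (fun n : int => \det (g x) ^ n)
    (fun m n => expfzDr m n (gn0 x)) (expr0z _)).
  by apply: eq_bigr => e /eqP ->.
rewrite -expfzDr // exprnP; congr (_ ^ _).
rewrite /euler_weight /euler_form /dimZ (bigD1 x) //= eqxx mulr1.
rewrite big1 ?addr0 => [|y /negPf ->]; last by rewrite mulr0.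
rewrite [X in _ - X + _](bigID (fun e => qhead e == x)) /= [X in _ - (_ + X)]big1 => [|e /negPf ->].
  by rewrite addr0 (eq_bigr (fun e => (b (qtail e))%:Z)) ?subrK // => e ->; rewrite mulr1.
by rewrite mulr0.
Qed.

End DeterminantalSemiInvariants.

(** * The two implications *)

Section SemistabilityOfSemiInvariants.
Variables (R : realType) (Q : quiver).
Local Notation C := R[i].
Local Notation tofrac := (@FracField.tofrac _).
Implicit Types (a b c : dimension Q).

Lemma eq_Sigma_support a (s s' : weight Q) :
  (forall x, a x != 0%N -> s x = s' x) -> Sigma R a s -> Sigma R a s'.
Proof.
move=> ss' [f [fpol fsi] fV]; exists f => //; split=> // g gu V.
rewrite fsi //; congr (_ * _); apply: eq_bigr => x _.
have [ax0|/ss' -> //] := eqVneq (a x) 0%N.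
have -> : \det (g x) = 1.
  by move: (g x); rewrite ax0 => M; rewrite det_mx00.
by rewrite !exp1rz.
Qed.

Lemma Sigma_univ_quot b a c (s : weight Q) (W : mrep {fraction {mpoly C[_]}} c) :
  Sigma R a s -> is_quot (map_rep tofrac (univr C b a)) W ->
  0 <= weight_eval s (dimZ c).
Proof.
move=> [f fsi [V0 fV0]] qW; have [[p fp] _] := fsi.
pose g := mmap (@mpolyC _ _) (fun i : 'I_#|Defs.coord a| => let d := enum_val i in
  univr C b a (tag d) (tagged d).1 (tagged d).2) p.
have gE v : g.@[v] = f (map_rep (meval v) (univr C b a)).
  rewrite fp; apply: rmorph_mmap => [z|i] /=; first exact: mevalC.
  by rewrite /coord_val /map_rep [RHS]mxE.
have g0 : g != 0.
  have [v hv] := univr_eval b V0; apply: contraNneq fV0 => g0.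
  by rewrite -(eq_rep hv) -gE g0 meval0.
have [v gv [W0 qW0]] := quot_specialize (pchar_complex R) qW g0.
by apply: SI_quot_weight fsi _ qW0; rewrite -gE.
Qed.

Lemma Sigma_ext_zero b c : Sigma R c (euler_weight (dimZ b)) ->
  exists B : mrep C b, exists W : mrep C c, ext_zero B W.
Proof.
move=> sig; have := SI_weight_zero sig; rewrite euler_weightE => e0.
pose B := map_rep tofrac (univl C b c); pose W := map_rep tofrac (univr C b c).
have : ext_zero B W.
  apply: generic_pair_ext_zero; [exact/pchar_frac/pchar_complex|exact: generic_univ|].
  by move=> d D qD; rewrite -euler_weightE; exact: Sigma_univ_quot sig qD.
(* Specialization is available for Hom; since <b, c> = 0, the statement for Ext passes through it
   and back. *)
move=> /(hom_ext_zero B W e0).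
move=> /(hom_zero_specialize (pchar_complex R))[B0 [W0 h]].
by exists B0, W0; apply/(hom_ext_zero B0 W0 e0).
Qed.

Lemma Sigma_necessary a b (s : weight Q) : Sigma R a s -> dim_le b a ->
  Sigma R (dim_sub a b) (euler_weight (dimZ b)) -> weight_eval s (dimZ b) <= 0.
Proof.
move=> sig ba /Sigma_ext_zero[B [W extBW]].
have abc x : a x = (b x + dim_sub a b x)%N by rewrite subnKC.
have [f fsi fV] := sig.
have [V fV0 [W' qW']] := SI_nonzero_quot abc extBW fsi fV.
have := SI_quot_weight fsi fV0 qW'; have := SI_weight_zero sig.
by rewrite (weight_add s abc) => /eqP; rewrite addr_eq0 => /eqP ->; rewrite oppr_le0.
Qed.

Lemma exists_max_int (T : Type) (P : T -> Prop) (mu : T -> int) (M : int) :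
  (exists t, P t) -> (forall t, P t -> mu t <= M) ->
  exists2 t, P t & forall t', P t' -> mu t' <= mu t.
Proof.
move=> [t Pt] ub; have [m] := ubnP (absz (M - mu t)); elim: m t Pt => // m IHm t Pt lem.
have [h|nh] := EM (forall t', P t' -> mu t' <= mu t); first by exists t.
have [t' [Pt' lt]] : exists t', P t' /\ mu t < mu t'.
  apply: contrapT => h; apply: nh => t' Pt'; rewrite leNgt; apply/negP => lt.
  by apply: h; exists t'.
by apply: (IHm t' Pt'); have := ub _ Pt'; move: lem lt; lia.
Qed.

Lemma is_sub_le (F : fieldType) u a (U : mrep F u) (A : mrep F a) :
  is_sub U A -> forall x, (u x <= a x)%N.
Proof. by move=> [i [r [_ ri]]] x; exact: rank_retract (ri x). Qed.

Lemma generic_semistable a (s : weight Q) n (A : mrep {fraction {mpoly C[n]}} a) c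
    (W : mrep {fraction {mpoly C[n]}} c) :
  generic_rep A -> weight_eval s (dimZ a) = 0 ->
  (forall b, dim_le b a -> Sigma R (dim_sub a b) (euler_weight (dimZ b)) ->
     weight_eval s (dimZ b) <= 0) ->
  is_quot A W -> 0 <= weight_eval s (dimZ c).
Proof.
move=> genA sa0 sle qW; rewrite leNgt; apply/negP => sc.
pose tot (u : dimension Q) : int := \sum_x (u x)%:Z.
(* [mu] orders subrepresentations lexicographically, by [s] first and then by total dimension, which
   never reaches [big]. *)
pose big : int := tot a + 1.
pose mu : weight Q := fun x => s x * big + 1.
have muE u : weight_eval mu (dimZ u) = big * weight_eval s (dimZ u) + tot u.
  rewrite /weight_eval mulr_sumr -big_split; apply: eq_bigr => x _.
  by rewrite /mu /dimZ /=; ring.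
have tot_ge0 u : 0 <= tot u by apply: sumr_ge0.
have tot_le u : (forall x, u x <= a x)%N -> tot u <= tot a.
  by move=> ua; apply: ler_sum => x _; rewrite lez_nat.
pose P (t : {u : dimension Q & mrep {fraction {mpoly C[n]}} u}) := is_sub (tagged t) A.
have [||[u U] /= subU maxU] := @exists_max_int _ P (fun t => weight_eval mu (dimZ (tag t)))
    (\sum_x `|mu x| * (a x)%:Z).
- by exists (Tagged _ A); exists (fun x => 1%:M), (fun x => 1%:M); split=> [e|x]; rewrite ?mulmx1 ?mul1mx.
- move=> [u U] /= /is_sub_le ua; apply: ler_sum => x _; rewrite /dimZ.
  apply: le_trans (ler_norm _) _; rewrite normrM.
  by rewrite ler_wpM2l // ger0_norm // lez_nat.
have {}subU : is_sub U A := subU.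
have maxS v (V : mrep _ v) : is_sub V A -> weight_eval mu (dimZ v) <= weight_eval mu (dimZ u).
  by move=> subV; exact: (maxU (Tagged _ V)).
(* The kernel of A -> W has positive weight, hence [mu] at least [big], which a subrepresentation of
   nonpositive weight cannot reach. *)
have spos : 0 < weight_eval s (dimZ u).
  have [p [r [hp pr]]] := qW; have [V [i [q hses]]] := quot_ses hp pr.
  have := maxS _ _ (ses_sub hses); rewrite !muE.
  have := weight_add s (ses_dim hses); rewrite sa0.
  have := tot_le _ (is_sub_le subU); have := tot_ge0 (dim_sub a c).
  move=> tv0 tua sv le_mu; rewrite ltNge; apply/negP => su0.
  have big0 : 0 <= big by rewrite addr_ge0.
  have := mulr_ge0_le0 big0 su0.
  have : big <= big * weight_eval s (dimZ (dim_sub a c)) by apply: ler_peMr => //; lia.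
  by move: le_mu; rewrite /big; lia.
have [i [r [hi ri]]] := subU; have [D [t [p hses]]] := sub_ses hi ri.
have extUD := generic_ses_ext_zero genA hses.
(* For f : U -> D with image J, the kernel of f gives mu(J) >= 0 and the preimage W' of J in A gives
   mu(J) <= 0. Then the total dimension of J is a multiple of [big] smaller than [big], hence
   zero. *)
have homUD : hom_zero U D.
  move=> f hf x.
  have [J [iJ [pJ [hiJ hpJ fE [rJ rJiJ] [sJ pJsJ]]]]] := image_factor hf (fun x => erefl (\rank (f x))).
  have [K [iK [rK sesU]]] := quot_ses hpJ pJsJ.
  have [D' [t' [p' sesD]]] := sub_ses hiJ rJiJ.
  have muK := maxS _ _ (sub_trans (ses_sub sesU) subU).
  have [p2 [s2 [hp2 p2s2]]] := quot_trans (ses_quot hses) (ses_quot sesD).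
  have [W' [i3 [r3 sesW]]] := quot_ses hp2 p2s2.
  have muW := maxS _ _ (ses_sub sesW).
  have e1 := weight_add mu (ses_dim sesU).
  have e2 := weight_add mu (ses_dim sesD).
  have e3 := weight_add mu (ses_dim sesW).
  have e4 := weight_add mu (ses_dim hses).
  have mu0 : weight_eval mu (dimZ (fun x => \rank (f x))) = 0 by lia.
  have j0 : tot (fun x => \rank (f x)) = 0.
    have := tot_ge0 (fun x => \rank (f x)).
    have : tot (fun x => \rank (f x)) <= tot a.
      apply: tot_le => y; apply: leq_trans (rank_leq_col _) _.
      exact: is_sub_le subU y.
    move=> tja tj0; have big0 : 0 <= big by rewrite addr_ge0.
    move: mu0; rewrite muE; set sj := weight_eval s _ => mu0.
    have [sj0|sj0|sj0] := ltgtP sj 0.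
    - have : big <= big * - sj by apply: ler_peMr => //; lia.
      by move: mu0; rewrite mulrN /big; lia.
    - have := mulr_ge0 big0 (ltW sj0); move: mu0; lia.
    - by move: mu0; rewrite sj0 mulr0 add0r.
  apply/eqP; rewrite -mxrank_eq0; move/eqP: j0; rewrite psumr_eq0 //.
  by move/allP/(_ x (mem_index_enum _)) => /=; rewrite eqz_nat.
have euler0 : euler_form (dimZ u) (dimZ (dim_sub a u)) = 0.
  by apply/eqP; rewrite eq_le (hom_zero_euler homUD) (ext_zero_euler extUD).
have [U0 [D0 h0]] := hom_zero_specialize (pchar_complex R) homUD.
have := sle u (is_sub_le subU) (Sigma_cobd_det euler0 h0).
by rewrite leNgt spos.
Qed.

End SemistabilityOfSemiInvariants.

(** * Acyclic quivers and weights of the form <beta, .> *)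

Section AcyclicQuivers.
Variable Q : quiver.
Implicit Types (a b c d : dimension Q).

(** The height of a vertex counts the arrows that begin a path ending there; crossing [e] adds [e]
    itself, which would otherwise lie on an oriented cycle. *)
Lemma acyclic_height : acyclic_quiver Q ->
  exists h : vertex Q -> nat, forall e, (h (qtail e) < h (qhead e))%N.
Proof.
move=> acyc; pose r : rel (arrow Q) := fun e f => qhead e == qtail f.
pose up x := [set e | [exists f, (qhead f == x) && connect r e f]].
exists (fun x => #|up x|) => e; apply: proper_card; apply/properP; split.
  apply/subsetP => f; rewrite !inE => /existsP[g /andP[/eqP ge rfg]].
  apply/existsP; exists e; rewrite eqxx /=; apply: connect_trans rfg _.
  by apply: connect1; rewrite /r ge.
exists e; first by rewrite inE; apply/existsP; exists e; rewrite eqxx connect0.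
rewrite inE; apply/negP => /existsP[f /andP[/eqP fe /connectP[p pe lf]]].
have := acyc (e :: p) isT; rewrite /= rcons_path pe /= -lf.
by rewrite fe eqxx.
Qed.

(** The equation <beta, .> = s on the support of [a], with beta = 0 elsewhere, is triangular for the
    height and is solved height by height. *)
Lemma exists_euler_dual (h : vertex Q -> nat) a (s : weight Q) :
  (forall e, (h (qtail e) < h (qhead e))%N) ->
  exists beta : vertex Q -> int, forall x, beta x =
    if a x == 0%N then 0 else s x + \sum_(e | qhead e == x) beta (qtail e).
Proof.
move=> hlt.
have [n] : exists n, forall x, (h x < n)%N.
  exists (\max_x h x).+1 => x; rewrite ltnS; exact: leq_bigmax.
suff IH m : exists beta : vertex Q -> int, forall x, (h x < m)%N -> beta x =
    if a x == 0%N then 0 else s x + \sum_(e | qhead e == x) beta (qtail e).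
  by move=> hn; have [beta hb] := IH n; exists beta => x; exact: hb.
elim: m => [|m [beta hb]]; first by exists (fun _ => 0).
exists (fun x => if (h x < m)%N then beta x else
  if a x == 0%N then 0 else s x + \sum_(e | qhead e == x) beta (qtail e)).
move=> x hx; have E : \sum_(e | qhead e == x) (if (h (qtail e) < m)%N then beta (qtail e) else
      if a (qtail e) == 0%N then 0
      else s (qtail e) + \sum_(f | qhead f == qtail e) beta (qtail f))
    = \sum_(e | qhead e == x) beta (qtail e).
  apply: eq_bigr => e /eqP ex; have -> // : (h (qtail e) < m)%N.
  by apply: leq_trans (hlt e) _; rewrite ex -ltnS.
by rewrite E; case: ifP => // hxm; rewrite hb.
Qed.

End AcyclicQuivers.

Section EulerDual.
Variables (Q : quiver) (F : fieldType).
Variables (h : vertex Q -> nat) (a : dimension Q) (A : mrep F a).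
Variables (s : weight Q) (beta : vertex Q -> int).
Hypothesis hlt : forall e, (h (qtail e) < h (qhead e))%N.
Hypothesis betaE : forall x, beta x =
  if a x == 0%N then 0 else s x + \sum_(e | qhead e == x) beta (qtail e).
Hypothesis semistable : forall c (W : mrep F c), is_quot A W -> 0 <= weight_eval s (dimZ c).

(** No arrow leads from outside [S] into [S], so the part of A outside [S] is a
    subrepresentation. *)
Let restrict_quot (S : pred (vertex Q)) : (forall e, S (qhead e) -> S (qtail e)) ->
  exists C : mrep F (fun x => if S x then a x else 0%N), is_quot A C.
Proof.
move=> Scl; pose c x := if S x then a x else 0%N.
suff : exists C : mrep F c, is_quot A C by [].
pose p : fam0 F c a := fun x => \matrix_(i, j) ((i : nat) == j)%:R.
pose t : fam0 F a c := fun x => \matrix_(i, j) ((i : nat) == j)%:R.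
have tp x : S x -> t x *m p x = 1%:M.
  rewrite /t /p /c; case: (S x) => // _; apply/matrixP=> i j; rewrite !mxE.
  rewrite (bigD1 i) //= !mxE eqxx mul1r big1 ?addr0 // => k ki.
  by rewrite !mxE (negPf (_ : (i : nat) != k)) ?mul0r // eq_sym.
have pt x : p x *m t x = 1%:M.
  rewrite /t /p /c; case: (S x); apply/matrixP=> i j; last by case: i.
  rewrite !mxE (bigD1 i) //= !mxE eqxx mul1r big1 ?addr0 // => k ki.
  by rewrite !mxE (negPf (_ : (i : nat) != k)) ?mul0r // eq_sym.
exists (fun e => p (qhead e) *m A e *m t (qtail e)), p, t; split=> // e.
have [/Scl/tp E|/negP nS] := EM (S (qhead e)); first by rewrite -[LHS]mulmxA E mulmx1.
by apply/matrixP=> i; exfalso; move: i; rewrite /c (negPf nS) => -[].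
Qed.

Let euler_simple (y : vertex Q) (d : dimension Q) :
  euler_form (dimZ (fun z => nat_of_bool (z == y))) (dimZ d)
  = (d y)%:Z - \sum_(e | qtail e == y) (d (qhead e))%:Z.
Proof.
rewrite /euler_form /dimZ (bigD1 y) //= eqxx mul1r big1 ?addr0 => [|z /negPf -> //].
  congr (_ - _); rewrite [RHS]big_mkcond; apply: eq_bigr => e _.
  by case: (_ == _); rewrite ?mul1r ?mul0r.
Qed.

(** Induction on height. A quotient D of A with full dimension at [x], nothing else at that height
    or above, and no maps from the simples S_y for y other than [x] satisfies <S_y, D> <= 0. In s(D)
    = sum of beta(y) <S_y, D> >= 0, the terms other than that of [x] are nonpositive. *)
Lemma euler_dual_ge0 x : 0 <= beta x.
Proof.
have [m] := ubnP (h x); elim: m x => // m IHm x /ltnSE lem.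
have [ax0|ax0] := eqVneq (a x) 0%N; first by rewrite betaE ax0.
pose S y := (y == x) || (h y < h x)%N.
have [e|C0 qC0] := @restrict_quot S.
  move=> /orP[/eqP ex|lt]; apply/orP; right; first by rewrite -ex hlt.
  exact: ltn_trans (hlt e) lt.
pose b y := nat_of_bool (y != x).
(* [B] is the direct sum of the simples at all vertices other than [x]; killing its images leaves
   the dimension at [x] intact. *)
pose B : mrep F b := fun e => 0.
pose P d (D : mrep F d) := d x = a x /\ forall y, y != x -> (h x <= h y)%N -> d y = 0%N.
have [||d [D [qCD [dx d0] homBD]]] := @kill_images _ _ _ _ B C0 P.
- split=> [|y yx le]; rewrite /S ?eqxx // (negPf yx) ltnNge le //.
- move=> d D j J d' D' i r q p [dx d0] qBJ sesD.
  have jx : j x = 0%N.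
    have [p' [q' [_ pq]]] := qBJ.
    by have := rank_retract (pq x); rewrite /b eqxx leqn0 => /eqP.
  have dE := ses_dim sesD; split=> [|y yx le]; first by rewrite -dx dE jx.
  by have := d0 y yx le; rewrite dE => /eqP; rewrite addn_eq0 => /andP[_ /eqP].
have qAD := quot_trans qC0 qCD.
have da y : (d y <= a y)%N.
  by have [p [q [_ pq]]] := qAD; exact: rank_retract (pq y).
have simple_le0 y : y != x -> (d y)%:Z - \sum_(e | qtail e == y) (d (qhead e))%:Z <= 0.
  move=> yx; rewrite -euler_simple.
  pose Sy : mrep F (fun z => nat_of_bool (z == y)) := fun e => 0.
  apply: (@hom_zero_euler _ _ _ _ Sy D) => f hf z.
  pose pr : 'M[F]_(z == y, b z) := const_mx 1.
  pose inc : 'M[F]_(b z, z == y) := const_mx 1.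
  have E : pr *m inc = 1%:M.
    rewrite /pr /inc /b; have [->|_] := eqVneq z y; last by apply/matrixP; case.
    by rewrite yx; apply/matrixP=> i j; rewrite !mxE big_ord1 !mxE mulr1 !ord1.
  have hom : is_hom B D (fun z => f z *m (const_mx 1 : 'M_(z == y, b z))).
    by move=> e; rewrite mulmxA hf /Sy mulmx0 mul0mx /B mulmx0.
  by rewrite -[f z]mulmx1 -E mulmxA (homBD _ hom z) mul0mx.
have := semistable qAD.
have -> : weight_eval s (dimZ d) =
    \sum_y beta y * ((d y)%:Z - \sum_(e | qtail e == y) (d (qhead e))%:Z).
  under [RHS]eq_bigr => y _ do rewrite mulrBr mulr_sumr.
  rewrite sumrB.
  have -> : \sum_y \sum_(e | qtail e == y) beta y * (d (qhead e))%:Z =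
      \sum_e beta (qtail e) * (d (qhead e))%:Z.
    rewrite [RHS](partition_big (@qtail Q) xpredT) //=.
    by apply: eq_bigr => y _; apply: eq_bigr => e /eqP ->.
  rewrite [X in _ - X](partition_big (@qhead Q) xpredT) //= -sumrB.
  apply: eq_bigr => y _; rewrite /dimZ.
  have -> : \sum_(e | qhead e == y) beta (qtail e) * (d (qhead e))%:Z =
      (\sum_(e | qhead e == y) beta (qtail e)) * (d y)%:Z.
    by rewrite mulr_suml; apply: eq_bigr => e /eqP ->.
  rewrite -mulrBl [beta y]betaE; case: eqP => [ay0|_]; last by rewrite addrK.
  by have := da y; rewrite ay0 leqn0 => /eqP ->; rewrite !mulr0.
have above e y : qtail e = y -> (h x <= h y)%N -> d (qhead e) = 0%N.
  move=> ey le; have lt : (h x < h (qhead e))%N by apply: leq_ltn_trans le _; rewrite -ey.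
  by apply: d0 (ltnW lt); apply: contraTneq lt => ->; rewrite ltnn.
rewrite (bigD1 x) //= dx big1 ?subr0 => [|e /eqP ex]; last by rewrite (above e x).
move=> ge0; have : 0 <= beta x * (a x)%:Z.
  apply: le_trans ge0 _; rewrite gerDl; apply: sumr_le0 => y yx.
  have [lt|le] := ltnP (h y) (h x).
    by apply: mulr_ge0_le0 (simple_le0 y yx); apply: IHm; exact: leq_trans lt lem.
  rewrite d0 // big1 ?subr0 ?mulr0 // => e /eqP ey.
  by rewrite (above e y).
by rewrite pmulr_lge0 // ltz_nat lt0n.
Qed.

End EulerDual.

Lemma Sigma_sufficient (R : realType) (Q : quiver) (a : dimension Q) (s : weight Q) :
  acyclic_quiver Q -> weight_eval s (dimZ a) = 0 ->
  (forall b, dim_le b a -> Sigma R (dim_sub a b) (euler_weight (dimZ b)) ->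
     weight_eval s (dimZ b) <= 0) ->
  Sigma R a s.
Proof.
move=> acyc sa0 sle; have [h hlt] := acyclic_height acyc.
have [beta betaE] := exists_euler_dual a s hlt.
pose b : dimension Q := fun x => absz (beta x).
pose B := map_rep (@FracField.tofrac _) (univl R[i] b a).
pose A := map_rep (@FracField.tofrac _) (univr R[i] b a).
have genBA : generic_pair B A := @generic_univ Q R[i] b a.
have semi c (W : mrep _ c) : is_quot A W -> 0 <= weight_eval s (dimZ c).
  by apply: generic_semistable (generic_pairr genBA) sa0 sle.
have bE x : (b x)%:Z = beta x by rewrite gez0_abs // (euler_dual_ge0 hlt betaE semi).
(* The weights agree only on the support of [a]; this is enough, as dimensions of quotients of A
   vanish off it. *)
have wE x : a x != 0%N -> euler_weight (dimZ b) x = s x.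
  move=> ax; rewrite /euler_weight /euler_form /dimZ (bigD1 x) //= eqxx mulr1.
  rewrite big1 ?addr0 => [|y /negPf ->]; last by rewrite mulr0.
  rewrite bE betaE (negPf ax) -addrA; apply/eqP; rewrite -subr_eq0 addrAC subrr add0r.
  rewrite [X in X - _]big_mkcond subr_eq0; apply/eqP; apply: eq_bigr => e _.
  by rewrite bE; case: eqP; rewrite ?mulr1 ?mulr0.
have evalE c : (forall x, c x <= a x)%N ->
    euler_form (dimZ b) (dimZ c) = weight_eval s (dimZ c).
  move=> ca; rewrite -euler_weightE; apply: eq_bigr => x _.
  have [ax0|/wE -> //] := eqVneq (a x) 0%N.
  by have := ca x; rewrite ax0 leqn0 /dimZ => /eqP ->; rewrite !mulr0.
have e0 : euler_form (dimZ b) (dimZ a) = 0 by rewrite evalE.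
have : ext_zero B A.
  apply: generic_pair_ext_zero genBA _; first exact/pchar_frac/pchar_complex.
  move=> c W qW; rewrite evalE; first exact: semi qW.
  by have [p [r [_ pr]]] := qW => x; exact: rank_retract (pr x).
move=> /(hom_ext_zero B A e0).
move=> /(hom_zero_specialize (pchar_complex R))[B0 [A0 h0]].
exact: eq_Sigma_support wE (Sigma_cobd_det e0 h0).
Qed.

Theorem theorem1p3 (R : realType) (Q : quiver) (alpha : dimension Q) :
  acyclic_quiver Q ->
  forall sigma : weight Q,
    Sigma R alpha sigma <->
    (weight_eval sigma (dimZ alpha) = 0 /\
     forall beta : dimension Q, dim_le beta alpha ->
       Sigma R (dim_sub alpha beta) (euler_weight (dimZ beta)) ->
       weight_eval sigma (dimZ beta) <= 0).
Proof.
move=> acyc sigma; split=> [sig|[sa0 sle]].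
  by split; [exact: SI_weight_zero sig|move=> beta; exact: Sigma_necessary sig].
exact: Sigma_sufficient.
Qed.
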